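(* Let $\mathcal{H}$ be a real Hilbert space, let $r \in \,]0,\infty[$, and let $\mathscr{C}_r(\mathcal{H})$ be the family of $r$-prox-regular subsets of $\mathcal{H}$. Assume that $\mathcal{C} : [0,\infty[\, \to \mathscr{C}_r(\mathcal{H})$ is $1$-Lipschitz continuous with respect to the excess $\mathrm{e}$ in the following sense: $$\mathrm{e}(\mathcal{C}(s),\mathcal{C}(t)) \le t-s \qquad \forall t,s \in [0,\infty[,\ s<t. \qquad ( * )$$ If $y_0 \in \mathcal{C}(0) + B_r(0)$, then there exists a unique function $y : [0,\infty[\, \to \mathcal{H}$ such that $$y(t) \in \mathcal{C}(t) \quad \forall t \in [0,\infty[,$$ $$y'(t) \in -N_{\mathcal{C}(t)}(y(t)) \quad \text{for Lebesgue-a.e. } t \in [0,\infty[,$$ $$y(0) = \mathrm{P}_{\mathcal{C}(0)}(y_0).$$ Moreover $y \in \mathrm{Lip}([0,\infty[;\mathcal{H})$ and its Lipschitz constant satisfies $\mathrm{Lip}[y] \le 1$. This unique solution is denoted by $\mathsf{S}(\mathcal{C},y_0)$, so that, if $$D_{\mathrm{Lip}} := \{(\mathcal{C},y_0) \in BR_{\mathrm{loc}}([0,\infty[;\mathscr{C}_r(\mathcal{H})) \times \mathcal{H} : ( * ) \text{ holds},\ y_0 \in \mathcal{C}(0)+B_r(0)\},$$ one can define $\mathsf{S} : D_{\mathrm{Lip}} \to \mathrm{Lip}([0,\infty[;\mathcal{H})$, the solution operator associating with every pair $(\mathcal{C},y_0)$ the only $y$ satisfying the three conditions above.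
   Context: $\mathcal{H}$ is a real Hilbert space with inner product $\langle\cdot,\cdot\rangle$ and norm $\|\cdot\|$. For $\rho>0$, $B_\rho(x) = \{y \in \mathcal{H} : \|y-x\|<\rho\}$; sums of sets are Minkowski sums. For $\mathcal{Z}\subseteq\mathcal{H}$ nonempty and $x\in\mathcal{H}$, $\mathrm{d}_{\mathcal{Z}}(x)=\mathrm{d}(x,\mathcal{Z}) := \inf_{s \in \mathcal{Z}}\|x-s\|$ and $\mathrm{Proj}_{\mathcal{Z}}(x) := \{z \in \mathcal{Z} : \|z-x\| = \mathrm{d}_{\mathcal{Z}}(x)\}$. Normal cone: if $\mathcal{K}\subseteq\mathcal{H}$ is nonempty and closed and $x\in\mathcal{K}$, the (exterior proximal) normal cone of $\mathcal{K}$ at $x$ is $N_{\mathcal{K}}(x) := \{\lambda(y-x) : x \in \mathrm{Proj}_{\mathcal{K}}(y),\ y\in\mathcal{H},\ \lambda\ge 0\}$. Prox-regularity: for $r\in\,]0,\infty[$, a nonempty closed set $\mathcal{K}\subseteq\mathcal{H}$ is $r$-prox-regular if for every $y\in\mathcal{H}$ with $0<\mathrm{d}_{\mathcal{K}}(y)<r$ one has $\mathrm{Proj}_{\mathcal{K}}(y)\ne\varnothing$ and $x \in \mathrm{Proj}_{\mathcal{K}}\big(x + r\frac{y-x}{\|y-x\|}\big)$ for all $x\in\mathrm{Proj}_{\mathcal{K}}(y)$. In that case $\mathrm{Proj}_{\mathcal{K}}(y)$ is a singleton for every $y$ with $\mathrm{d}_{\mathcal{K}}(y)<r$, and $\mathrm{P}_{\mathcal{K}}(y)$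 denotes its unique element. Excess: for $\mathcal{Z}_1,\mathcal{Z}_2\subseteq\mathcal{H}$, $\mathrm{e}(\mathcal{Z}_1,\mathcal{Z}_2) := \sup_{z_1\in\mathcal{Z}_1} \mathrm{d}(z_1,\mathcal{Z}_2)\in[0,\infty]$. Local bounded retraction: $BR_{\mathrm{loc}}([0,\infty[;\mathscr{C}_r(\mathcal{H}))$ is the set of maps $\mathcal{C}:[0,\infty[\,\to\mathscr{C}_r(\mathcal{H})$ such that, for every compact interval $J\subseteq[0,\infty[$, the supremum of $\sum_{j=1}^m \mathrm{e}(\mathcal{C}(t_{j-1}),\mathcal{C}(t_j))$ over all $m\ge 1$ and all $t_0<\cdots<t_m$ in $J$ is finite. Lipschitz functions: for $f:[0,\infty[\,\to\mathcal{H}$, $\mathrm{Lip}[f] := \sup\{\|f(t)-f(s)\|/|t-s| : s\ne t\}$, and $\mathrm{Lip}([0,\infty[;\mathcal{H})$ is the set of those $f$ with $\mathrm{Lip}[f]<\infty$.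
   Formalization: Uniqueness is stated among locally absolutely continuous functions y; among arbitrary functions it fails (for C(t)=H every step function starting at y_0 satisfies the three conditions). *)

(* Defs.v *)
From mathcomp Require Import all_boot all_order all_algebra.
From mathcomp Require Import all_classical all_reals all_analysis.

Set Implicit Arguments.
Unset Strict Implicit.
Unset Printing Implicit Defensive.

Import Order.TTheory GRing.Theory Num.Theory.
Import numFieldNormedType.Exports.

Local Open Scope classical_set_scope.
Local Open Scope ring_scope.

(* Functions and set-valued maps on [0, +oo[ are represented by functions on
   the whole of R; all notions below only involve their values at t >= 0,
   except that the derivative at t = 0, a null set, is two-sided. *)

(* Meaningful for nonempty Z only: inf set0 = 0 in MathComp-Analysis. *)
Definition dist (R : realType) (H : normedModType R) (x : H) (Z : set H) : R :=
  inf [set `|x - s| | s in Z].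

Definition Proj (R : realType) (H : normedModType R) (Z : set H) (x : H) :
    set H :=
  [set z | Z z /\ `|z - x| = dist x Z].

(* The element of Proj Z x when this is a singleton; a choice otherwise. *)
Definition metric_proj (R : realType) (H : normedModType R) (Z : set H)
    (x : H) : H :=
  get (Proj Z x).

Definition normal_cone (R : realType) (H : normedModType R) (K : set H)
    (x : H) : set H :=
  [set v | exists (lambda : R) (y : H),
     [/\ 0 <= lambda, Proj K y x & v = lambda *: (y - x)]].

Definition prox_regular (R : realType) (H : normedModType R) (r : R)
    (K : set H) : Prop :=
  [/\ K !=set0, closed K
    & forall y, 0 < dist y K < r ->
        Proj K y !=set0 /\
        forall x, Proj K y x -> Proj K (x + (r / `|y - x|) *: (y - x)) x].

(* Meaningful for nonempty sets only: ereal_sup set0 = -oo. *)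
Definition excess (R : realType) (H : normedModType R) (Z1 Z2 : set H) :
    \bar R :=
  ereal_sup [set (dist z Z2)%:E | z in Z1].

Definition prox_regular_map (R : realType) (H : normedModType R) (r : R)
    (C : R -> set H) : Prop :=
  forall t, 0 <= t -> prox_regular r (C t).

Definition excess_1lipschitz (R : realType) (H : normedModType R)
    (C : R -> set H) : Prop :=
  forall s t, 0 <= s -> s < t -> (excess (C s) (C t) <= (t - s)%:E)%E.

Definition retraction (R : realType) (H : normedModType R) (C : R -> set H)
    (a b : R) : \bar R :=
  ereal_sup [set v | exists (m : nat) (t : nat -> R),
    [/\ (0 < m)%N,
        forall i, (i <= m)%N -> a <= t i <= b,
        forall i, (i < m)%N -> t i < t i.+1
      & v = (\sum_(0 <= j < m) excess (C (t j)) (C (t j.+1)))%E]].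

Definition BR_loc (R : realType) (H : normedModType R) (r : R) :
    set (R -> set H) :=
  [set C | prox_regular_map r C /\
     forall a b, 0 <= a -> a <= b -> (retraction C a b < +oo)%E].

Definition Lip_const (R : realType) (H : normedModType R) (f : R -> H) :
    \bar R :=
  ereal_sup [set v | exists s t, [/\ 0 <= s, 0 <= t, s != t
    & v = (`|f t - f s| / `|t - s|)%:E]].

Definition Lip (R : realType) (H : normedModType R) : set (R -> H) :=
  [set f | (Lip_const f < +oo)%E].

Definition loc_abs_cont (R : realType) (H : normedModType R) (f : R -> H) :
    Prop :=
  forall T e : R, 0 < e -> exists2 d : R, 0 < d &
    forall (n : nat) (a b : nat -> R),
      (forall i, (i < n)%N -> [/\ 0 <= a i, a i <= b i & b i <= T]) ->
      trivIset `I_n (fun i => `]a i, b i[%classic) ->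
      \sum_(0 <= i < n) (b i - a i) < d ->
      \sum_(0 <= i < n) `|f (b i) - f (a i)| < e.

Definition sweeping_solution (R : realType) (H : normedModType R)
    (C : R -> set H) (y0 : H) (y : R -> H) : Prop :=
  [/\ forall t, 0 <= t -> C t (y t),
      {ae @lebesgue_measure R, forall t, 0 <= t ->
         derivable y t 1 /\ normal_cone (C t) (y t) (- derive1 y t)}
    & y 0 = metric_proj (C 0) y0].

(* Without a regularity requirement uniqueness fails: for the constant map
   C t = setT every step function starting from y0 satisfies the three
   conditions of sweeping_solution. As usual for differential inclusions,
   the competitors are the locally absolutely continuous functions. *)
Definition unique_solution (R : realType) (H : normedModType R)
    (C : R -> set H) (y0 : H) (y : R -> H) : Prop :=
  [/\ loc_abs_cont y, sweeping_solution C y0 y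
    & forall z, loc_abs_cont z -> sweeping_solution C y0 z ->
        forall t, 0 <= t -> z t = y t].

Definition thickening (R : realType) (H : normedModType R) (A : set H)
    (r : R) : set H :=
  [set a + b | a in A & b in ball (0 : H) r].

Definition D_Lip (R : realType) (H : normedModType R) (r : R) :
    set ((R -> set H) * H) :=
  [set p | [/\ BR_loc r p.1, excess_1lipschitz p.1 & thickening (p.1 0) r p.2]].

(* Main.v *)
From HB Require Import structures.
Require Import Defs.
From mathcomp Require Import all_boot all_order all_algebra.
From mathcomp Require Import all_classical all_reals all_analysis.
From mathcomp Require Import measurable_realfun ring lra.

Set Implicit Arguments.
Unset Strict Implicit.
Unset Printing Implicit Defensive.

Import Order.TTheory GRing.Theory Num.Theory.
Import numFieldNormedType.Exports.

Local Open Scope classical_set_scope.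
Local Open Scope ring_scope.

(** Existence. The approximations are those of the catching-up algorithm: with a
    time step [h], each new position is a metric projection of the previous one
    on the set at the next time. A projection step [v] is a proximal normal
    vector of length at most [h], so prox-regularity gives [<v, c - x> <= |v| /
    (2 r) |c - x|^2] for the points [c] of the new set, and the excess bound
    transfers this to the points [p] of every earlier set, with an error of
    second order in time ([catching_up_normal]). Points of later sets are out of
    reach, since the excess is not symmetric. Tested on the positions of a run
    on a finer grid, and conversely, this inequality gives a discrete Gronwall
    estimate: the two runs stay at distance [O(sqrt h)] ([refinement_dist]). So
    the approximations converge on dyadic grids, to a 1-Lipschitz curve [y] with
    [y t] in [C t] ([sweep_lipschitz], [sweep_in]).

    The differential inclusion is obtained point by point. Summing the same
    inequality over the steps between [s] and [t] bounds the growth of [|p -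
    y|^2] for every [p] in [C s] ([sweep_evolution]). Dividing by [t - s] and
    letting [t] tend to [s] at a point where [y] is derivable yields [<- y' s, p
    - y s> <= |p - y s|^2 / (2 r)], which says exactly that [y s] is a
    projection of [y s - r y' s] on [C s] ([sweep_normal]).

    It remains that a Lipschitz curve in a Hilbert space, separable or not, is
    derivable almost everywhere ([lipschitz_ae_derivable]). A real Lipschitz
    function is the primitive of a bounded density, by the Radon-Nikodym theorem
    applied to a Lebesgue-Stieltjes measure ([lipschitz_density]). Take the
    scalar functions [<y, u_k>], where the [u_k] are the directions of the
    rational chords of [y]; the supremum [m] of their densities is the speed of
    [y], in the sense that [|y b - y a|] is at most the integral of [m]
    ([chord_speed]). At almost every [t] the difference quotients thus have norm
    at most [m t + e] and a scalar product at least [m t - e] with some [u_k],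
    and the parallelogram identity makes them Cauchy ([derivable_of_speed]).

    Uniqueness. For every absolutely continuous solution [z], comparing [z t]
    with [z s] for [s] slightly before [t] shows [|z' t| <= 1] almost everywhere
    ([solution_speed]), so [z] is 1-Lipschitz. The normal inequality, used at
    both of two solutions, then gives [(|z - y|^2)' <= (2 / r) |z - y|^2] almost
    everywhere, and Gronwall's lemma concludes ([gronwall_eq0]). Both steps rest
    on the fact that an absolutely continuous real function whose derivative is
    almost everywhere nonpositive is nonincreasing ([ac_nonincreasing]). *)

(** * First-order expansions *)

Section Differentiation.
Context (R : realType) (V : normedModType R).
Implicit Types (f : R -> V) (t e : R).

Lemma derivable_cvg f t : derivable f t 1 ->
  h^-1 *: (f (h + t) - f t) @[h --> 0^'] --> derive1 f t.
Proof.
rewrite /derivable /derive1 => dft.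
suff E : (fun h : R => h^-1 *: ((f \o shift t) (h *: 1) - f t)) =
         (fun h : R => h^-1 *: (f (h + t) - f t)) by rewrite E in dft.
by apply/funext => h /=; rewrite [_%:A]mulr1.
Qed.

Lemma derivable_expansion f t e : derivable f t 1 -> 0 < e ->
  exists2 d : R, 0 < d & forall h, `|h| < d ->
    `|f (t + h) - f t - h *: derive1 f t| <= e * `|h|.
Proof.
move=> /derivable_cvg /cvgrPdist_le cv /cv[d /= d0 H].
exists d => // h hd; have [->|h0] := eqVneq h 0.
  by rewrite addr0 subrr scale0r subr0 !normr0 mulr0.
have := H h; rewrite /= sub0r normrN => /(_ hd h0).
have -> : f (t + h) - f t - h *: derive1 f t =
    - (h *: (derive1 f t - h^-1 *: (f (h + t) - f t))).
  by rewrite scalerBr scalerA divff// scale1r opprB (addrC h).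
by rewrite normrN normrZ mulrC ler_pM2r ?normr_gt0.
Qed.

Lemma expansion_derivable f t (w : V) :
  (forall e, 0 < e -> exists2 d : R, 0 < d & forall h, `|h| < d ->
    `|f (t + h) - f t - h *: w| <= e * `|h|) ->
  derivable f t 1 /\ derive1 f t = w.
Proof.
move=> H.
have cv : h^-1 *: (f (h + t) - f t) @[h --> 0^'] --> w.
  apply/cvgrPdist_le => e /H[d d0 {}H].
  exists d => // h; rewrite /= sub0r normrN => hd h0.
  have -> : w - h^-1 *: (f (h + t) - f t) =
      - (h^-1 *: (f (t + h) - f t - h *: w)).
    by rewrite [in RHS]scalerBr scalerA mulVf// scale1r opprB (addrC h).
  by rewrite normrN normrZ normfV mulrC ler_pdivrMr ?normr_gt0// H.
split; last exact: (cvg_lim (@norm_hausdorff _ V) cv).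
apply/cvg_ex; exists w.
suff -> : (fun h : R => h^-1 *: ((f \o shift t) (h *: 1) - f t)) =
         (fun h : R => h^-1 *: (f (h + t) - f t)) by [].
by apply/funext => h /=; rewrite [_%:A]mulr1.
Qed.

End Differentiation.

(** * Monotonicity of absolutely continuous functions *)

Section MonotoneAC.
Context (R : realType).
Notation mu := (@lebesgue_measure R).

(** The supremum of the points of [S] in [[a, b]] can be straddled, so it is [b]
    and is reached.  The hypothesis jumps over [c] in one step: this is how an
    interval around its tag is appended to a tagged partition. *)
Lemma real_induction (S : set R) (a b : R) : a <= b -> S a ->
  (forall c, a <= c <= b -> exists2 d : R, 0 < d &
    forall x v, a <= x -> x <= c <= v -> v <= b -> c - d < x -> v < c + d ->
      S x -> S v) ->
  S b.
Proof.
move=> ab Sa step.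
pose A := S `&` `[a, b]%classic.
have Aa : A a by split => //=; rewrite in_itv/= lexx ab.
have ubA : ubound A b by move=> x [_ /=]; rewrite in_itv/= => /andP[].
have supA : has_sup A by split; [exists a|exists b].
have asup : a <= sup A by apply: ub_le_sup => //; exact: supA.2.
have supb : sup A <= b by apply: ge_sup => //; exact: supA.1.
have [d d0 H] := step (sup A) (introT andP (conj asup supb)).
have [x [Sx xab] dx] := sup_adherent d0 supA.
move: xab; rewrite /= in_itv/= => /andP[ax xb].
have xs : x <= sup A.
  by apply: ub_le_sup; [exact: supA.2|split => //=; rewrite in_itv/= ax xb].
have [bd|db] := ltP b (sup A + d).
  by apply: (H x b) => //; rewrite xs supb.
have Sv : S (sup A + d / 2).
  apply: (H x) => //; rewrite ?xs/= ?lerDl ?ltrD2l; lra.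
have : sup A + d / 2 <= sup A.
  apply: ub_le_sup; first exact: supA.2.
  by split => //=; rewrite in_itv/=; apply/andP; split; lra.
lra.
Qed.

(** Intervals listed from left to right are disjoint, so additivity of the
    measure bounds their total length. *)
Lemma sum_itv_le_measure (n : nat) (a b : nat -> R) (U : set R) (d : R) :
  open U -> (mu U < d%:E)%E ->
  (forall i, (i < n)%N -> a i <= b i) ->
  (forall i j, (i < j)%N -> (j < n)%N -> b i <= a j) ->
  (forall i, (i < n)%N -> `]a i, b i[ `<=` U) ->
  trivIset `I_n (fun i => `]a i, b i[%classic) /\
  \sum_(0 <= i < n) (b i - a i) < d.
Proof.
move=> oU mUd ab ba sub.
have tI : trivIset `I_n (fun i => `]a i, b i[%classic).
  move=> i j /= ni nj [x []]; rewrite /= !in_itv/= => /andP[aix xbi] /andP[ajx xbj].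
  case: (ssrnat.ltngtP i j) => // ij.
    by exfalso; have := ba i j ij nj; lra.
  by exfalso; have := ba j i ij ni; lra.
split => //; rewrite -lte_fin; apply: le_lt_trans mUd.
rewrite big_mkord -sumEFin.
pose F i : set R := `]a i, b i[%classic.
have -> : (\sum_(i < n) (b i - a i)%:E = \sum_(i < n) mu (F i))%E.
  apply: eq_bigr => i _; rewrite /F lebesgue_measure_itv/= lte_fin.
  case: ltP => //; have := ab _ (ltn_ord i) => h1 h2.
  by congr (_%:E); lra.
rewrite -(measure_bigsetU_ord _ xpredT).
- apply: le_measure; rewrite ?inE.
  + by apply: bigsetU_measurable => i _; exact: measurable_itv.
  + exact: open_measurable.
  + by rewrite -(bigcup_mkord n F) => x [i /= /sub]; exact.
- by move=> i; exact: measurable_itv.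
- by move=> i j _ _ /tI - /(_ (ltn_ord i) (ltn_ord j)) /val_inj.
Qed.



Lemma open_cover_negligible (Z : set R) (d : R) : mu.-negligible Z -> 0 < d ->
  exists U : set R, [/\ open U, Z `<=` U & (mu U < d%:E)%E].
Proof.
move=> [N [mN N0 ZN]] d0.
have [|U [oU NU UNd]] := lebesgue_regularity_outer mN _ d0; first by rewrite [X in (X < _)%E]N0.
exists U; split => //; first exact: subset_trans NU.
apply: le_lt_trans UNd.
have mU : measurable U by exact: open_measurable.
rewrite -[X in (mu X <= _)%E](setDUK NU).
have /le_trans := measureU2 mu mN (measurableD mU mN); apply.
by rewrite [X in (X + _)%E]N0 add0e.
Qed.

(** Cousin-style argument: cut [[a, b]] into small intervals around tags.  Around
    a tag outside [Z], [f] grows at rate at most [e].  The other intervals lie in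
    an open set of small measure that covers [Z], so their total length is small
    and absolute continuity bounds the growth of [f] on all of them together.
    The growth hypothesis is stated on intervals that straddle [t] because the
    cutting points need not be tags. *)
Lemma ac_nonincreasing (f : R -> R) (Z : set R) :
  @loc_abs_cont R R^o f -> mu.-negligible Z ->
  (forall t, 0 <= t -> ~ Z t -> forall e, 0 < e -> exists2 d : R, 0 < d &
    forall u v, 0 <= u -> u <= t <= v -> t - d < u -> v < t + d ->
      f v - f u <= e * (v - u)) ->
  forall a b, 0 <= a -> a <= b -> f b <= f a.
Proof.
move=> acf nZ dec a b a0 ab.
suff H e : 0 < e -> f b - f a <= e * (b - a) + e.
  rewrite -subr_le0; apply/ler_addgt0Pr => e e0; rewrite add0r.
  have k0 : 0 < b - a + 1 by lra.
  apply: (le_trans (H (e / (b - a + 1)) (divr_gt0 e0 k0))).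
  by rewrite -[X in _ * _ + X]mulr1 -mulrDr divfK// gt_eqF.
move=> e0; have [d d0 acd] := acf b e e0.
have [U [oU ZU mUd]] := open_cover_negligible nZ d0.
(* [al] and [be] list the intervals, up to [x], whose tags are in [Z];
   the growth on all the others is in the term [e * (x - a)]. *)
pose P x n (al be : nat -> R) := [/\
  forall i, (i < n)%N -> [/\ a <= al i, al i <= be i & be i <= x],
  forall i j, (i < j)%N -> (j < n)%N -> be i <= al j,
  forall i, (i < n)%N -> `]al i, be i[ `<=` U &
  f x - f a <= e * (x - a) + \sum_(0 <= i < n) `|f (be i) - f (al i)|].
pose S x := exists n al be, P x n al be.
have : S b.
  apply: (@real_induction S a b ab).
    exists 0%N, (fun=> 0), (fun=> 0); split => //.
    by rewrite !subrr mulr0 big_nil addr0.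
  move=> c /andP[ac cb].
  have [Zc|Zc] := pselect (Z c).
    have /nbhs_ballP[d1 /= d10 bU] : nbhs c U by exact: open_nbhs_nbhs (conj oU (ZU _ Zc)).
    exists d1 => // x v ax /andP[xc cv] vb dx vd [n [al [be [H1 H2 H3 H4]]]].
    have xv : x <= v by lra.
    exists n.+1, (fun i => if (i < n)%N then al i else x),
      (fun i => if (i < n)%N then be i else v); split.
    - move=> i _; case: ifP => // /H1 [h1 h2 h3]; split => //; exact: le_trans xv.
    - move=> i j ij; rewrite ltnS => jn.
      have -> : (i < n)%N by exact: leq_trans jn.
      case: ifP => [/(H2 _ _ ij)//|_].
      by have [] := H1 i (leq_trans ij jn).
    - move=> i _; case: ifP => [/H3//|_] z /=; rewrite in_itv/= => /andP[xz zv].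
      by apply: bU; rewrite /ball/= ltr_distl; apply/andP; split; lra.
    - rewrite big_nat_recr//= ltnn (eq_big_nat _ _ (F2 := fun i => `|f (be i) - f (al i)|)); last first.
        by move=> i /andP[_ ->].
      have h1 := ler_norm (f v - f x).
      have h2 : e * (x - a) <= e * (v - a) by rewrite ler_pM2l//; lra.
      lra.
  have [d1 d10 Hd] := dec c (le_trans a0 ac) Zc e e0.
  exists d1 => // x v ax xcv vb dx vd [n [al [be [H1 H2 H3 H4]]]].
  have xv : x <= v by case/andP: xcv => h1 h2; lra.
  exists n, al, be; split => //.
    by move=> i /H1 [h1 h2 h3]; split => //; exact: le_trans xv.
  have := Hd x v (le_trans a0 ax) xcv dx vd => h.
  have -> : e * (v - a) = e * (v - x) + e * (x - a) by rewrite -mulrDr; congr (_ * _); lra.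
  lra.
move=> [n [al [be [H1 H2 H3 H4]]]].
have [tI sl] := sum_itv_le_measure oU mUd (fun i hi => let: And3 _ h _ := H1 i hi in h) H2 H3.
apply: (le_trans H4); rewrite lerD2l ltW//.
apply: acd tI sl => i /H1 [h1 h2 h3]; split => //; exact: le_trans h1.
Qed.

End MonotoneAC.

(** * Densities of real Lipschitz functions *)

Section LipschitzDensity.
Context (R : realType).
Notation mu := (@lebesgue_measure R).

Lemma lebesgue_stieltjes_itv (F : cumulative R R) (a b : R) : a <= b ->
  lebesgue_stieltjes_measure F `]a, b]%classic = (F b - F a)%:E.
Proof.
move=> ab; rewrite /lebesgue_stieltjes_measure /measure_extension/=.
rewrite measurable_mu_extE.
  exact: wlength_itv_bnd.
exact: is_ocitv.
Qed.

(** The semiring of the Lebesgue-Stieltjes construction consists of half-open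
    intervals, which may be given by endpoints in the wrong order. *)
Lemma wlength_lipschitz (F : cumulative R R) (k : R) (A : set R) : 0 <= k ->
  (forall a b, a <= b -> F b - F a <= k * (b - a)) -> ocitv A ->
  (wlength F A <= k%:E * wlength idfun A)%E.
Proof.
move=> k0 Fk [[a b] _ <-] /=; have [ab|ba] := leP a b.
  by rewrite !wlength_itv_bnd// -EFinM lee_fin Fk.
rewrite set_itv_ge; last by rewrite bnd_simp -leNgt ltW.
by rewrite !wlength0 mule0.
Qed.

(** A cover of [A] by half-open intervals of small total length also bounds
    the outer measure induced by [F], up to the factor [k]. *)
Lemma lebesgue_stieltjes_dominated (F : cumulative R R) (k : R) : 0 <= k ->
  (forall a b, a <= b -> F b - F a <= k * (b - a)) ->
  lebesgue_stieltjes_measure F `<< mu.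
Proof.
move=> k0 Fk; apply/null_content_dominatesP => A mA A0.
apply/eqP; rewrite eq_le measure_ge0 andbT; apply/lee_addgt0Pr => e e0.
have k10 : 0 < k + 1 by lra.
have : (mu A < (e / (k + 1))%:E)%E by rewrite [X in (X < _)%E]A0 lte_fin divr_gt0.
move=> /ereal_inf_lt[_ [B [mB AB] <-] Bs].
rewrite add0e; apply: (@le_trans _ _ (\sum_(i <oo) wlength F (B i))%E).
  by apply: ereal_inf_lbound; exists B.
apply: (@le_trans _ _ (k%:E * \sum_(i <oo) wlength idfun (B i))%E).
  rewrite -nneseriesZl//.
  apply: lee_nneseries => [i *|i *]; first exact: wlength_ge0.
  exact: (wlength_lipschitz k0 Fk (mB i)).
apply: (@le_trans _ _ (k%:E * (e / (k + 1))%:E)%E).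
  by rewrite lee_wpmul2l ?lee_fin// ltW.
rewrite -EFinM lee_fin mulrCA ler_piMr ?ler_pdivrMr ?mul1r; lra.
Qed.

(** Radon-Nikodym, for the Lebesgue-Stieltjes measure of [F] cut off outside
    [`]0, N]] so as to be finite. *)
Lemma monotone_lipschitz_density (F : cumulative R R) (k N : R) : 0 <= k ->
  0 <= N -> (forall a b, a <= b -> F b - F a <= k * (b - a)) ->
  exists2 h : R -> R, mu.-integrable setT (EFin \o h) &
    forall a b, 0 <= a -> a <= b -> b <= N ->
      (\int[mu]_(x in `]a, b]) h x)%R = F b - F a.
Proof.
move=> k0 N0 Fk.
have mD : measurable (`]0, N]%classic : set (measurableTypeR R)) by exact: measurable_itv.
have Doo : (lebesgue_stieltjes_measure F `]0%R, N]%classic < +oo)%E.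
  by rewrite lebesgue_stieltjes_itv// ltry.
pose nu : {finite_measure set _ -> \bar R} := mfrestr mD Doo.
have numu : nu `<< mu.
  apply/null_content_dominatesP => A mA A0.
  have /null_content_dominatesP dom := lebesgue_stieltjes_dominated k0 Fk.
  apply: dom; first exact: measurableI.
  apply/eqP; rewrite eq_le measure_ge0 andbT -A0.
  by apply: le_measure; rewrite ?inE//; exact: measurableI.
have [g [g0 gfin ig gE]] := radon_nikodym_sigma_finite numu.
have gK : EFin \o (fine \o g) = g by apply/funext => x /=; rewrite fineK.
exists (fine \o g); first by rewrite gK.
move=> a b a0 ab bN; rewrite /Rintegral.
under eq_integral do rewrite /= fineK//.
rewrite -gE; last exact: measurable_itv.
rewrite /nu/= /mfrestr /mrestr (_ : _ `&` _ = `]a, b]%classic).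
  by rewrite lebesgue_stieltjes_itv.
apply/seteqP; split => [x []//|x /= xab]; split => //.
by move: xab; rewrite /= !in_itv/= => /andP[h1 h2]; apply/andP; split; lra.
Qed.


(** [f + id] is nondecreasing and 2-Lipschitz, so it has a density [h], and
    [h - 1] is a density of [f].  At almost every point of [`]0, N]] it is the
    derivative of [f], hence is in [[-1, 1]]; truncating it makes the bound hold
    everywhere. *)
Lemma lipschitz_density (f : R -> R) (N : R) : 0 <= N ->
  (forall x y, `|f x - f y| <= `|x - y|) ->
  exists g : R -> R, [/\ measurable_fun setT g, forall x, `|g x| <= 1 &
    forall a b, 0 <= a -> a <= b -> b <= N ->
      (\int[mu]_(x in `]a, b]) g x)%R = f b - f a].
Proof.
move=> N0 fl.
pose F x := f x + x.
have Fnd : {homo F : x y / x <= y}.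
  move=> x y xy; have := fl x y; rewrite (ler0_norm (_ : x - y <= 0)); last lra.
  by rewrite /F => h; have := ler_norm (f x - f y); lra.
have Frc x : F @ at_right x --> F x.
  apply: cvg_within_filter; apply/cvgrPdist_le => e e0; near=> t.
  have -> : F x - F t = (f x - f t) + (x - t) by rewrite /F; lra.
  apply: (le_trans (ler_normD _ _)); have := fl x t => h.
  suff : `|x - t| <= e / 2 by lra.
  by near: t; apply: cvgr_dist_le; [exact: cvg_id|rewrite divr_gt0].
pose Fc : cumulative R R := HB.pack F (isCumulative.Build R _ R F Fnd Frc).
have Fk a b : a <= b -> Fc b - Fc a <= 2 * (b - a).
  move=> ab; have := fl b a; rewrite (ger0_norm (_ : 0 <= b - a)); last lra.
  by rewrite /Fc/= /F => h; have := ler_norm (f b - f a); lra.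
(* The margin makes [N] an interior point. *)
have N10 : 0 <= N + 1 by lra.
have [h ih hE] := monotone_lipschitz_density (ler0n R 2) N10 Fk.
pose P x := (\int[mu]_(t in `]0%R, x]) h t)%R.
have Pae : {ae mu, forall x, (BRight 0 < BRight x)%O ->
    derivable P x 1 /\ derive1 P x = h x}.
  apply: (FTC1 (a := BRight 0)); last by apply: open_integrable_locally => //; exact: openT.
  by move=> y; apply: integrableS ih.
have PE x y : 0 <= x -> x <= y -> y <= N + 1 -> P y - P x = f y - f x + (y - x).
  move=> x0 xy yN; rewrite /P !hE//; [|lra|lra].
  rewrite /Fc/= /F; lra.
have bnd x : 0 < x -> x <= N -> derivable P x 1 -> derive1 P x = h x -> `|h x - 1| <= 1.
  move=> x0 xN dP Px; apply/ler_addgt0Pr => e e0.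
  have [d d0 H] := derivable_expansion dP e0.
  pose k := Num.min (d / 2) 1.
  have k0 : 0 < k by rewrite lt_min divr_gt0//=.
  have kd : k <= d / 2 by rewrite ge_min lexx.
  have k1 : k <= 1 by rewrite ge_min lexx orbT.
  have := H k; rewrite gtr0_norm// Px => /(_ ltac:(lra)).
  rewrite PE; [|lra|lra|lra].
  have := fl (x + k) x; rewrite (_ : x + k - x = k); last lra.
  rewrite (gtr0_norm k0) => fk Hk.
  rewrite -(ler_pM2l k0) -{1}(gtr0_norm k0) -normrM.
  have -> : k * (h x - 1) = (f (x + k) - f x) - (f (x + k) - f x + k - k *: h x).
    rewrite [k *: _]mulrC; ring.
  apply: (le_trans (ler_normB _ _)); lra.
pose g x := Num.max (-1) (Num.min 1 (h x - 1)).
have mh : measurable_fun setT h by move/integrableP : ih => [/measurable_EFinP].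
have mg : measurable_fun setT g.
  apply: measurable_maxr => //; apply: measurable_minr => //.
  exact: measurable_funB.
exists g; split => //.
  move=> x; rewrite ler_norml /g le_max lexx/= ge_max ge_min lexx/= andbT; lra.
move=> a b a0 ab bN.
have mab : measurable (`]a, b]%classic : set (measurableTypeR R)) by exact: measurable_itv.
have i1 : mu.-integrable `]a, b] (EFin \o cst (1 : R)).
  apply: measurable_bounded_integrable => //.
    by rewrite /= lebesgue_measure_itv/=; case: ifP => _; rewrite -?EFinB ltry.
  exact: bounded_cst.
have ih' : mu.-integrable `]a, b] (EFin \o h) by apply: integrableS ih.
transitivity (\int[mu]_(x in `]a, b]) (h x - 1))%R.
  rewrite /Rintegral; congr fine; apply: ae_eq_integral => //.
  - by apply/measurable_EFinP; exact: measurable_funTS.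
  - by apply/measurable_EFinP; apply: measurable_funTS; exact: measurable_funB.
  - move: Pae; apply: filterS; first exact: (ae_filter_ringOfSetsType mu).
    move=> x Px /=; rewrite in_itv/= => /andP[ax xb].
    have x0 : 0 < x by lra.
    have [d1 d2] := Px x0; congr (_%:E).
    have := bnd x x0 ltac:(lra) d1 d2; rewrite ler_norml /g => /andP[h1 h2].
    by rewrite (min_idPr _)// (max_idPr _).
rewrite RintegralB// hE//; last lra.
rewrite Rintegral_cst// mul1r /= lebesgue_measure_itv/= lte_fin.
rewrite /Fc/= /F; case: ltP => ab' /=; lra.
Unshelve. all: by end_near. Qed.

End LipschitzDensity.

(** * Real inner products *)

Section InnerProduct.
Context (R : realType) (H : normedModType R) (inner : {dot H for idfun})
  (inner_norm : forall x : H, inner x x = `|x| ^+ 2).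
Implicit Types x y z : H.

Lemma innerC x y : inner x y = inner y x.
Proof. by have := hermC inner x y; rewrite expr0 mul1r. Qed.

Lemma innerDl x y z : inner (x + y) z = inner x z + inner y z.
Proof. exact: linearDl. Qed.

Lemma innerNl x y : inner (- x) y = - inner x y.
Proof. exact: linearNl. Qed.

Lemma innerZl a x y : inner (a *: x) y = a * inner x y.
Proof. exact: linearZl_LR. Qed.

Lemma innerBl x y z : inner (x - y) z = inner x z - inner y z.
Proof. by rewrite innerDl innerNl. Qed.

Lemma innerDr x y z : inner x (y + z) = inner x y + inner x z.
Proof. by rewrite innerC innerDl !(innerC x). Qed.

Lemma innerNr x y : inner x (- y) = - inner x y.
Proof. by rewrite innerC innerNl innerC. Qed.

Lemma innerBr x y z : inner x (y - z) = inner x y - inner x z.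
Proof. by rewrite innerDr innerNr. Qed.

Lemma innerZr a x y : inner x (a *: y) = a * inner x y.
Proof. by rewrite innerC innerZl innerC. Qed.

Lemma sqr_normD x y : `|x + y| ^+ 2 = `|x| ^+ 2 + 2 * inner x y + `|y| ^+ 2.
Proof. rewrite -!inner_norm innerDl !innerDr (innerC y x); ring. Qed.

Lemma sqr_normB x y : `|x - y| ^+ 2 = `|x| ^+ 2 - 2 * inner x y + `|y| ^+ 2.
Proof. rewrite sqr_normD innerNr normrN; ring. Qed.

Lemma inner_le x y : inner x y <= `|x| * `|y|.
Proof.
have [->|x0] := eqVneq x 0.
  by rewrite normr0 mul0r -(scale0r 0) innerZl mul0r.
have nx : 0 < `|x| by rewrite normr_gt0.
have : 0 <= `| `|y| *: x - `|x| *: y| ^+ 2 by exact: sqr_ge0.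
rewrite sqr_normB !normrZ !normr_id innerZl innerZr => h.
have [->|y0] := eqVneq y 0.
  by rewrite normr0 mulr0 -(scale0r 0) innerZr mul0r.
have ny : 0 < `|y| by rewrite normr_gt0.
have xy : 0 < 2 * (`|x| * `|y|) by rewrite !mulr_gt0.
rewrite -(ler_pM2l xy); lra.
Qed.

Lemma norm_inner_le x y : `|inner x y| <= `|x| * `|y|.
Proof.
rewrite ler_norml inner_le andbT -[leRHS]opprK lerN2 -innerNl.
by apply: (le_trans (inner_le _ _)); rewrite normrN.
Qed.

End InnerProduct.

(** * Lipschitz curves in a Hilbert space are derivable almost everywhere *)

Section HilbertDifferentiability.
Context (R : realType) (H : completeNormedModType R) (inner : {dot H for idfun})
  (inner_norm : forall x : H, inner x x = `|x| ^+ 2).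
Notation mu := (@lebesgue_measure R).

(** Two vectors of norm at most [n + e] whose component along the same unit
    direction is almost [n] have a sum of norm almost [2 n]; the parallelogram
    identity then makes their difference small. *)
Lemma uniform_convexity (n e : R) (u p q : H) : 0 <= n -> 0 < e -> `|u| <= 1 ->
  `|p| <= n + e -> `|q| <= n + e -> n - 2 * e <= inner p u ->
  n - 2 * e <= inner q u -> `|p - q| ^+ 2 <= e * (24 * n + 36 * e).
Proof.
move=> n0 e0 u1 pn qn pu qu.
have par : `|p - q| ^+ 2 = 2 * `|p| ^+ 2 + 2 * `|q| ^+ 2 - `|p + q| ^+ 2.
  by rewrite (sqr_normB inner_norm) (sqr_normD inner_norm); ring.
have p2 : `|p| ^+ 2 <= (n + e) ^+ 2 by rewrite lerXn2r ?nnegrE//; lra.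
have q2 : `|q| ^+ 2 <= (n + e) ^+ 2 by rewrite lerXn2r ?nnegrE//; lra.
have s1 : 2 * n - 4 * e <= `|p + q|.
  have : inner (p + q) u <= `|p + q| * 1.
    by apply: (le_trans (inner_le inner_norm _ _)); rewrite ler_wpM2l.
  rewrite (innerDl inner); lra.
have [ne|ne] := leP (2 * e) n.
  have : (2 * n - 4 * e) ^+ 2 <= `|p + q| ^+ 2 by rewrite lerXn2r ?nnegrE//; lra.
  rewrite par; nra.
have := sqr_ge0 `|p + q|; rewrite par; nra.
Qed.

(** Uniform convexity makes the difference quotients Cauchy: [G] bounds their norms
    by about [n], while their component along some [u k] is at least about
    [n]. *)
Lemma derivable_of_speed (y : R -> H) (t n : R) (u : nat -> H) (G : R -> R) :
  (forall k, `|u k| <= 1) -> 0 <= n ->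
  (forall k, derivable (fun s => inner (y s) (u k) : R^o) t 1) ->
  (forall e, 0 < e -> exists k, n - e <= derive1 (fun s => inner (y s) (u k) : R^o) t) ->
  derivable (G : R -> R^o) t 1 -> derive1 (G : R -> R^o) t = n ->
  (exists2 d, 0 < d & forall h, `|h| < d -> `|y (t + h) - y t| <= `|G (t + h) - G t|) ->
  derivable y t 1.
Proof.
move=> u1 n0 dfu nu dG Gn [d0 d00 yG].
rewrite /derivable; apply: cauchy_cvg; apply: cauchy_exP => e e0.
(* [ep] is chosen so that the bound of [uniform_convexity] is below [e ^+ 2]. *)
pose ep := Num.min 1 (e ^+ 2 / (2 * (24 * n + 36))).
have den : 0 < 2 * (24 * n + 36) by lra.
have ep0 : 0 < ep by rewrite lt_min ltr01 divr_gt0// exprn_gt0.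
have ep1 : ep <= 1 by rewrite ge_min lexx.
have epe : ep * (24 * n + 36 * ep) < e ^+ 2.
  have : ep <= e ^+ 2 / (2 * (24 * n + 36)) by rewrite ge_min lexx orbT.
  rewrite ler_pdivlMr// => h; have : 0 < e ^+ 2 by rewrite exprn_gt0.
  nra.
have [k nk] := nu ep ep0.
have [d1 d10 H1] := derivable_expansion dG ep0.
have [d2 d20 H2] := derivable_expansion (dfu k) ep0.
pose q (h : R) := h^-1 *: (y (t + h) - y t).
have qP h : h != 0 -> `|h| < d0 -> `|h| < d1 -> `|h| < d2 ->
    `|q h| <= n + ep /\ n - 2 * ep <= inner (q h) (u k).
  move=> h0 hd0 hd1 hd2; have nh : 0 < `|h| by rewrite normr_gt0.
  split.
    rewrite /q normrZ normfV ler_pdivrMl//.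
    apply: (le_trans (yG h hd0)).
    rewrite -(subrK (h * n) (G (t + h) - G t)).
    have := H1 h hd1; rewrite Gn => h1.
    apply: (le_trans (ler_normD _ _)).
    rewrite [`|h * n|]normrM (ger0_norm n0) mulrDr addrC lerD2l.
    by rewrite (mulrC `|h| ep).
  have := H2 h hd2; set D := derive1 _ _ => h2.
  have E : h * (inner (q h) (u k) - D) =
      inner (y (t + h)) (u k) - inner (y t) (u k) - h *: D.
    by rewrite /q (innerZl inner) (innerBl inner) mulrBr mulrA divff// mul1r.
  rewrite -E normrM (mulrC ep) ler_pM2l// ler_norml in h2.
  rewrite -/D in nk; case/andP: h2 => h2 _; lra.
pose d := Num.min d0 (Num.min d1 d2).
have d_gt0 : 0 < d by rewrite !lt_min d00 d10 d20.
have dP h : h != 0 -> `|h| < d -> `|q h| <= n + ep /\ n - 2 * ep <= inner (q h) (u k).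
  by move=> h0; rewrite !lt_min => /and3P[]; exact: qP.
have nd2 : `|d / 2| < d by rewrite gtr0_norm ?divr_gt0//; lra.
have d20' : d / 2 != 0 by rewrite gt_eqF// divr_gt0.
exists (q (d / 2)); exists d => // h; rewrite /= sub0r normrN => hd h0.
rewrite [_%:A]mulr1 (addrC h t) -ball_normE/= -/(q h).
have [a1 a2] := dP _ d20' nd2.
have [b1 b2] := dP _ h0 hd.
have := uniform_convexity n0 ep0 (u1 k) a1 b1 a2 b2.
rewrite -(ltr_pXn2r (_ : (0 < 2)%N)) ?nnegrE ?(ltW e0)// => /le_lt_trans; exact.
Qed.

End HilbertDifferentiability.

Section BoundedPrimitive.
Context (R : realType).
Notation mu := (@lebesgue_measure R).
Context (g : R -> R) (mg : measurable_fun setT g) (g1 : forall x, `|g x| <= 1).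
Let G x := (\int[mu]_(t in `]0%R, x]) g t)%R.

Lemma bounded_integrable (A : set (measurableTypeR R)) : measurable A ->
  (mu A < +oo)%E -> mu.-integrable A (EFin \o g).
Proof.
move=> mA Aoo; apply: measurable_bounded_integrable => //.
  exact: measurable_funTS.
exists 1; split => // M M1 x _ /=.
by rewrite (le_trans (g1 _))// ltW.
Qed.

Lemma bounded_integrable_itv (a b : R) : mu.-integrable `]a, b] (EFin \o g).
Proof.
apply: bounded_integrable; first exact: measurable_itv.
by rewrite /= lebesgue_measure_itv/=; case: ifP => _; rewrite -?EFinB ltry.
Qed.

Lemma primitive_increment (a b : R) : 0 <= a -> a <= b ->
  G b - G a = (\int[mu]_(t in `]a, b]) g t)%R.
Proof.
move=> a0 ab; rewrite /G Rintegral_itvB ?bnd_simp//.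
exact: bounded_integrable_itv.
Qed.

Lemma primitive_lipschitz (a b : R) : 0 <= a -> a <= b -> `|G b - G a| <= b - a.
Proof.
move=> a0 ab; rewrite primitive_increment//.
have mab : measurable (`]a, b]%classic : set (measurableTypeR R)) by exact: measurable_itv.
have i1 : mu.-integrable `]a, b] (EFin \o cst (1 : R)).
  apply: measurable_bounded_integrable => //.
    by rewrite /= lebesgue_measure_itv/=; case: ifP => _; rewrite -?EFinB ltry.
  exact: bounded_cst.
apply: (@le_trans _ _ (\int[mu]_(t in `]a, b]) (cst 1 t))%R); last first.
  rewrite Rintegral_cst// mul1r /= lebesgue_measure_itv/= lte_fin.
  by case: ltP => ab' /=; lra.
apply: le_trans (le_normr_Rintegral _ (bounded_integrable_itv a b)) _ => //.
apply: le_Rintegral => //.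
have /integrable_norm := bounded_integrable_itv a b.
by [].
Qed.

Lemma primitive_derivable : {ae mu, forall x, 0 < x ->
  derivable (G : R -> R^o) x 1 /\ derive1 (G : R -> R^o) x = g x}.
Proof.
apply: (FTC1 (a := BRight 0)); first by move=> y; exact: bounded_integrable_itv.
split => //; first exact: openT.
move=> K _ cK; have mK : measurable K by exact: compact_measurable.
have /integrableP[] := bounded_integrable mK (compact_finite_measure cK).
by [].
Qed.

End BoundedPrimitive.

Section HilbertAeDifferentiability.
Context (R : realType) (H : completeNormedModType R) (inner : {dot H for idfun})
  (inner_norm : forall x : H, inner x x = `|x| ^+ 2).
Notation mu := (@lebesgue_measure R).

Definition unit_vector (w : H) : H := `|w|^-1 *: w.

Lemma norm_unit_vector (w : H) : `|unit_vector w| <= 1.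
Proof.
rewrite /unit_vector normrZ normfV normr_id.
have [->|w0] := eqVneq w 0; first by rewrite normr0 mulr0.
by rewrite mulVf// normr_eq0.
Qed.

Lemma inner_unit_vector (w : H) : inner w (unit_vector w) = `|w|.
Proof.
rewrite /unit_vector (innerZr inner) inner_norm.
have [->|w0] := eqVneq w 0; first by rewrite normr0 expr0n mulr0.
by rewrite expr2 mulKf// normr_eq0.
Qed.

(** The directions of the chords of [y] between rational times: a countable
    family which is rich enough to recover the length of every chord, even when
    the space is not separable. *)
Definition chord_direction (y : R -> H) (k : nat) : H :=
  if unpickle k is Some (p, q) then unit_vector (y (ratr q) - y (ratr p)) else 0.

Lemma norm_chord_direction y k : `|chord_direction y k| <= 1.
Proof.
rewrite /chord_direction; case: unpickle => [[p q]|]; first exact: norm_unit_vector.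
by rewrite normr0.
Qed.

(** For a chord between rational times, the hypothesis for its own direction
    [u_k] reads [|y q - y p| <= G q - G p]; the general case follows by
    continuity of [y] and [G]. *)
Lemma chord_speed (y : R -> H) (G : R -> R) (N : R) :
  (forall s t, `|y s - y t| <= `|s - t|) ->
  (forall a b, 0 <= a -> a <= b -> `|G b - G a| <= b - a) ->
  (forall k a b, 0 <= a -> a <= b -> b <= N ->
    inner (y b) (chord_direction y k) - inner (y a) (chord_direction y k) <= G b - G a) ->
  forall a b, 0 <= a -> a <= b -> b <= N -> `|y b - y a| <= G b - G a.
Proof.
move=> yl Gl spd a b a0; rewrite le_eqVlt => /predU1P[<-|ab] bN.
  by rewrite !subrr normr0.
apply/ler_addgt0Pr => e e0.
pose d := Num.min (e / 4) ((b - a) / 2).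
have d0 : 0 < d by rewrite lt_min !divr_gt0//; lra.
have de : d <= e / 4 by rewrite ge_min lexx.
have db : d <= (b - a) / 2 by rewrite ge_min lexx orbT.
have ad : a < a + d by lra.
have bd : b - d < b by lra.
have [p] := rat_in_itvoo ad; rewrite in_itv/= => /andP[ap pd].
have [q] := rat_in_itvoo bd; rewrite in_itv/= => /andP[dq qb].
have p0 : 0 <= ratr p :> R by lra.
have pq : ratr p <= ratr q :> R by lra.
have qN : (ratr q : R) <= N by lra.
have ypq : `|y (ratr q) - y (ratr p)| <= G (ratr q) - G (ratr p).
  have := spd (pickle (p, q)) _ _ p0 pq qN.
  by rewrite /chord_direction pickleK -(innerBl inner) inner_unit_vector.
have y1 := yl b (ratr q); have y2 := yl (ratr p) a.
have G1 := Gl a (ratr p) a0 ltac:(lra); have G2 := Gl (ratr q) b ltac:(lra) ltac:(lra).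
have -> : y b - y a = (y b - y (ratr q)) + (y (ratr q) - y (ratr p)) + (y (ratr p) - y a).
  by rewrite !addrA subrK subrK.
have := ler_normD (y b - y (ratr q) + (y (ratr q) - y (ratr p))) (y (ratr p) - y a).
have := ler_normD (y b - y (ratr q)) (y (ratr q) - y (ratr p)).
rewrite (gtr0_norm (_ : 0 < b - ratr q)) in y1; last lra.
rewrite (gtr0_norm (_ : 0 < ratr p - a)) in y2; last lra.
move: G1 G2; rewrite !ler_norml => /andP[g1 g2] /andP[g3 g4].
lra.
Qed.

(** The density [m] is the pointwise supremum of the densities of the scalar
    functions [<y, u_k>].  At almost every [t] all these functions have their
    density as derivative, and so has the primitive [G] of [m]; the supremum
    property of [m t] then provides the direction that [derivable_of_speed]
    asks for. *)
Lemma lipschitz_derivable_itv (y : R -> H) (N : R) : 0 <= N ->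
  (forall s t, `|y s - y t| <= `|s - t|) ->
  {ae mu, forall t, 0 < t < N -> derivable y t 1}.
Proof.
move=> N0 yl; pose u := chord_direction y.
have ul k s t : `|inner (y s) (u k) - inner (y t) (u k)| <= `|s - t|.
  rewrite -(innerBl inner); apply: (le_trans (norm_inner_le inner_norm _ _)).
  apply: le_trans (yl s t); rewrite ler_piMr//; exact: norm_chord_direction.
have /choice[g gP] k := lipschitz_density N0 (ul k).
have mg k : measurable_fun setT (g k) by have [] := gP k.
have g1 k x : `|g k x| <= 1 by have [] := gP k.
have gE k a b : 0 <= a -> a <= b -> b <= N ->
    (\int[mu]_(x in `]a, b]) g k x)%R = inner (y b) (u k) - inner (y a) (u k).
  by have [] := gP k => _ _; apply.
pose m x := sups (g^~ x) 0.
have ubg x : has_ubound (range (g^~ x)).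
  by exists 1 => _ [k _ <-]; exact: le_trans (ler_norm _) (g1 k x).
have ubg0 x : has_ubound (sdrop (g^~ x) 0).
  by exists 1 => _ [k _ <-]; exact: le_trans (ler_norm _) (g1 k x).
have gm k x : g k x <= m x.
  by apply: ub_le_sup => //; exists k.
have m1 x : m x <= 1.
  apply: ge_sup; first by exists (g 0%N x); exists 0%N.
  by move=> _ [k _ <-]; exact: le_trans (ler_norm _) (g1 k x).
have mabs x : `|m x| <= 1.
  rewrite ler_norml m1 andbT; apply: le_trans (gm 0%N x).
  by have := g1 0%N x; rewrite ler_norml => /andP[].
have mm : measurable_fun setT m by apply: measurable_fun_sups => // x _; exact: ubg.
pose G x := (\int[mu]_(t in `]0%R, x]) m t)%R.
have yG : forall a b, 0 <= a -> a <= b -> b <= N -> `|y b - y a| <= G b - G a.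
  apply: chord_speed => //; first exact: primitive_lipschitz.
  move=> k a b a0 ab bN; rewrite -gE// /G primitive_increment//.
  apply: le_Rintegral => //.
  - exact: (bounded_integrable_itv (mg k) (g1 k)).
  - exact: bounded_integrable_itv.
have Gae := primitive_derivable mm mabs.
have gae := ae_foralln (fun k => primitive_derivable (mg k) (g1 k)).
move: Gae gae; apply: filterS2; first exact: (ae_filter_ringOfSetsType mu).
move=> t dG dg /andP[t0 tN].
have [dG1 dG2] := dG t0.
pose d := Num.min t (N - t).
have d0 : 0 < d by rewrite lt_min t0 subr_gt0.
have dt : d <= t by rewrite ge_min lexx.
have dN : d <= N - t by rewrite ge_min lexx orbT.
have fg k : derivable (fun s => inner (y s) (u k) : R^o) t 1 /\
    derive1 (fun s => inner (y s) (u k) : R^o) t = g k t.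
  have [P1 P2] := dg k t0; apply: expansion_derivable => e e0.
  have [d1 d10 H1] := derivable_expansion P1 e0.
  exists (Num.min d d1); first by rewrite lt_min d0.
  move=> h; rewrite lt_min => /andP[hd hd1]; have := H1 h hd1; rewrite P2.
  have E x : 0 <= x -> x <= N -> (\int[mu]_(t0 in `]0, x]) g k t0)%R =
      inner (y x) (u k) - inner (y 0) (u k) by move=> *; exact: gE.
  move: hd; rewrite ltr_norml => /andP[h1 h2].
  by rewrite !E ?opprB ?addrA ?subrK//; lra.
apply: (derivable_of_speed inner_norm (norm_chord_direction y) _ (fun k => (fg k).1) _ dG1 dG2).
(* [0 <= m t] because [G] is nondecreasing, by [yG]. *)
- apply/ler_addgt0Pr => e e0; have [d1 d10 H1] := derivable_expansion dG1 e0.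
  pose c := Num.min d d1; have c0 : 0 < c by rewrite lt_min d0.
  have cd : c <= d by rewrite ge_min lexx.
  have cd1 : c <= d1 by rewrite ge_min lexx orbT.
  pose h := c / 2; have h0 : 0 < h by rewrite divr_gt0.
  have hd1 : h < d1 by rewrite /h; lra.
  have hd : h < d by rewrite /h; lra.
  have := H1 h; rewrite gtr0_norm// dG2 => /(_ hd1).
  rewrite ler_norml => /andP[_ h1].
  have {}h1 : G (t + h) - G t - h * m t <= e * h by exact: h1.
  have h2 := le_trans (normr_ge0 _) (yG t (t + h) ltac:(lra) ltac:(lra) ltac:(lra)).
  rewrite -(ler_pM2l h0) mulr0 mulrDr; lra.
- move=> e e0; have [|_ [k _ <-] mk] := @sup_adherent _ (sdrop (g^~ t) 0) e e0.
    by split => //; exists (g 0%N t); exists 0%N.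
  by exists k; rewrite (fg k).2 ltW.
- exists d => // h; rewrite ltr_norml => /andP[h1 h2].
  have [h0|h0] := leP 0 h.
    apply: (le_trans (yG t (t + h) _ _ _)); rewrite ?lerDl//; [lra|lra|exact: ler_norm].
  rewrite distrC [leRHS]distrC.
  apply: (le_trans (yG (t + h) t _ _ _)); [lra|lra|lra|exact: ler_norm].
Qed.

Lemma lipschitz_ae_derivable (y : R -> H) :
  (forall s t, `|y s - y t| <= `|s - t|) ->
  {ae mu, forall t, 0 < t -> derivable y t 1}.
Proof.
move=> yl.
have := ae_foralln (fun n => lipschitz_derivable_itv (ler0n R n) yl).
apply: (@filterS _ _ (ae_filter_ringOfSetsType mu)) => t dt t0; apply: (dt (Num.bound t)).
by rewrite t0 archi_boundP// ltW.
Qed.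

End HilbertAeDifferentiability.

(** * Distance, excess and projections *)

Section Distance.
Context (R : realType) (H : normedModType R).
Implicit Types (x y z : H) (K Z : set H).

Lemma dist_has_lbound x Z : has_lbound [set `|x - s| | s in Z].
Proof. by exists 0 => _ [s _ <-]. Qed.

Lemma dist_le x Z s : Z s -> dist x Z <= `|x - s|.
Proof. by move=> Zs; apply: ge_inf; [exact: dist_has_lbound|exists s]. Qed.

Lemma dist_ge x Z (d : R) : Z !=set0 -> (forall s, Z s -> d <= `|x - s|) ->
  d <= dist x Z.
Proof.
by move=> [s Zs] Zd; apply: lb_le_inf; [exists `|x - s|, s|move=> _ [z /Zd + <-]].
Qed.

Lemma dist_lt x Z (d : R) : Z !=set0 -> dist x Z < d ->
  exists2 s, Z s & `|x - s| < d.
Proof.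
move=> Z0 xd; apply: contrapT => nZ; move: xd; rewrite ltNge => /negP; apply.
apply: dist_ge => // s Zs; rewrite leNgt; apply/negP => sd; apply: nZ.
by exists s.
Qed.

Lemma excess_dist (A B : set H) (e : R) z :
  (excess A B <= e%:E)%E -> A z -> dist z B <= e.
Proof.
move=> ABe Az; rewrite -lee_fin; apply: le_trans ABe.
by apply: ereal_sup_ubound; exists z.
Qed.

Lemma ProjP K y x : Proj K y x <-> K x /\ (forall c, K c -> `|y - x| <= `|y - c|).
Proof.
split=> [[Kx yx]|[Kx yx]]; split => //.
  by move=> c Kc; rewrite distrC yx dist_le.
rewrite distrC; apply/eqP; rewrite eq_le dist_le// andbT.
by apply: dist_ge => //; exists x.
Qed.

Lemma Proj_dist K y x : Proj K y x -> `|y - x| = dist y K.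
Proof. by move=> [_ <-]; rewrite distrC. Qed.

Lemma dist_eq0 K y : closed K -> K !=set0 -> dist y K <= 0 -> K y.
Proof.
move=> cK K0 y0; apply: cK => B /nbhs_ballP[e /= e0 eB].
have [|s Ks se] := @dist_lt y K e K0; first exact: le_lt_trans e0.
by exists s; split => //; apply: eB; rewrite -ball_normE.
Qed.

Lemma metric_projP K y : Proj K y !=set0 -> Proj K y (metric_proj K y).
Proof. by move=> /cid[x yx]; exact: getI yx. Qed.

Lemma prox_regular_Proj (r : R) K y : prox_regular r K -> dist y K < r ->
  Proj K y !=set0.
Proof.
move=> [K0 cK Kr] yr; have [yK|yK] := ltP 0 (dist y K).
  by have [] := Kr y; rewrite ?yK.
exists y; apply/ProjP; split; first exact: dist_eq0 yK.
by move=> c _; rewrite subrr normr0.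
Qed.

End Distance.

(** * Normal vectors of prox-regular sets *)

Section ProxNormal.
Context (R : realType) (H : normedModType R) (inner : {dot H for idfun})
  (inner_norm : forall x : H, inner x x = `|x| ^+ 2).
Implicit Types (x y c v : H) (K : set H).

(** Moving from [y] towards its projection [x] shortens the distance to [x]
    at full speed, and the distance to any other point at most as fast. *)
Lemma Proj_segment K y x (s : R) : 0 <= s <= 1 -> Proj K y x ->
  Proj K (x + s *: (y - x)) x.
Proof.
move=> /andP[s0 s1] /ProjP[Kx yx]; apply/ProjP; split => // c Kc.
rewrite [X in X - x]addrC addrK normrZ ger0_norm//.
have -> : x + s *: (y - x) - c = (y - c) - (1 - s) *: (y - x).
  by rewrite scalerBl scale1r !opprB [RHS]addrC -[RHS]addrA subrKA addrCA addrA.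
have := lerB_dist (y - c) ((1 - s) *: (y - x)).
rewrite normrZ (ger0_norm (_ : 0 <= 1 - s)); last lra.
have := yx c Kc; nra.
Qed.

(** Prox-regularity puts a ball of radius [r] that touches [K] at [x], with centre
    [x + u] in the direction of [v], outside [K]; expanding [|x + u - c| >= r]
    gives the inequality.  It holds for normal vectors of any length: a point
    close to [x] on the ray is at distance less than [r] from [K], so that the
    definition of prox-regularity applies to it. *)
Lemma prox_regular_normal (r : R) K x v c : 0 < r -> prox_regular r K ->
  normal_cone K x v -> K c -> inner v (c - x) <= `|v| / (2 * r) * `|c - x| ^+ 2.
Proof.
move=> r0 [K0 cK Kr] [l [y [l0 yx ->]]] Kc.
have [->|xy] := eqVneq y x.
  by rewrite subrr scaler0 normr0 !mul0r -(scale0r 0) (innerZl inner) mul0r.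
have n0 : 0 < `|y - x| by rewrite normr_gt0 subr_eq0.
pose s := Num.min 1 (r / (2 * `|y - x|)).
have s0 : 0 < s by rewrite lt_min ltr01 divr_gt0// mulr_gt0.
have s1 : s <= 1 by rewrite ge_min lexx.
have sr : s * `|y - x| < r.
  apply: (@le_lt_trans _ _ (r / 2)); last lra.
  rewrite -ler_pdivlMr//; apply: (@le_trans _ _ (r / (2 * `|y - x|))).
    by rewrite ge_min lexx orbT.
  by rewrite invfM mulrA.
have s01 : 0 <= s <= 1 by rewrite ltW.
have Pz := Proj_segment s01 yx; set z := x + _ in Pz.
have zx : z - x = s *: (y - x) by rewrite /z addrC addKr.
have nzx : `|z - x| = s * `|y - x| by rewrite zx normrZ gtr0_norm.
have [|_ /(_ x Pz)] := Kr z; first by rewrite -(Proj_dist Pz) nzx sr mulr_gt0.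
rewrite nzx zx scalerA (_ : r / (s * `|y - x|) * s = r / `|y - x|); last first.
  by field; rewrite !gt_eqF.
set u := _ *: (y - x) => /ProjP[Kx /(_ c Kc)].
have un : `|u| = r by rewrite normrZ gtr0_norm ?divr_gt0// divfK// gt_eqF.
rewrite [X in X - x]addrC addrK un => uc.
have : r ^+ 2 <= `|x + u - c| ^+ 2 by rewrite lerXn2r ?nnegrE// ltW.
have -> : x + u - c = u - (c - x) by rewrite opprB (addrC x) -addrA.
rewrite (sqr_normB inner_norm u) un => h.
have -> : l *: (y - x) = (l * `|y - x| / r) *: u.
  by rewrite /u scalerA; congr (_ *: _); field; rewrite !gt_eqF.
rewrite (innerZl inner) normrZ un.
have k0 : 0 <= l * `|y - x| / r by rewrite divr_ge0 ?mulr_ge0// ltW.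
rewrite ger0_norm// (_ : _ / (2 * r) * _ = l * `|y - x| / r * (`|c - x| ^+ 2 / 2)).
  by rewrite ler_wpM2l//; lra.
by field; rewrite gt_eqF.
Qed.

(** Conversely the inequality without the factor [|v|] says that [x] is a
    projection of [x + r *: v], by the same expansion. *)
Lemma normal_cone_of_le (r : R) K x v : 0 < r -> K x ->
  (forall c, K c -> inner v (c - x) <= `|c - x| ^+ 2 / (2 * r)) ->
  normal_cone K x v.
Proof.
move=> r0 Kx Kv; exists r^-1, (x + r *: v); split; first by rewrite invr_ge0 ltW.
  apply/ProjP; split => // c /Kv h.
  rewrite [X in X - x]addrC addrK.
  rewrite -(ler_pXn2r (_ : (0 < 2)%N))// ?nnegrE//.
  have -> : x + r *: v - c = r *: v - (c - x) by rewrite opprB (addrC x) -addrA.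
  rewrite (sqr_normB inner_norm (r *: v)) (innerZl inner).
  move: h; rewrite ler_pdivlMr ?mulr_gt0// => h; nra.
by rewrite [X in X - x]addrC addrK scalerA mulVf ?scale1r// gt_eqF.
Qed.

End ProxNormal.

(** * The catching-up algorithm *)

Section CatchingUp.
Context (R : realType) (H : normedModType R) (inner : {dot H for idfun})
  (inner_norm : forall x : H, inner x x = `|x| ^+ 2).
Context (r : R) (r_gt0 : 0 < r) (C : R -> set H) (y0 : H).
Context (Cr : prox_regular_map r C) (Ce : excess_1lipschitz C)
  (y0r : dist y0 (C 0) < r).

Lemma moving_dist (s t : R) (p : H) : 0 <= s -> s <= t -> C s p ->
  dist p (C t) <= t - s.
Proof.
move=> s0; rewrite le_eqVlt => /predU1P[<-|st] Cp.
  by rewrite subrr; apply: le_trans (dist_le _ Cp) _; rewrite subrr normr0.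
exact: excess_dist (Ce s0 st) Cp.
Qed.

Lemma moving_point (s t : R) (p : H) : 0 <= s -> s <= t -> t - s < r -> C s p ->
  exists2 c, C t c & `|p - c| <= t - s.
Proof.
move=> s0 st tsr Cp; have d := moving_dist s0 st Cp.
have [c pc] := prox_regular_Proj (Cr (le_trans s0 st)) (le_lt_trans d tsr).
by exists c; [have [] := pc|rewrite (Proj_dist pc)].
Qed.

Fixpoint catching_up (h : R) (k : nat) : H :=
  if k is j.+1 then metric_proj (C (k%:R * h)) (catching_up h j)
  else metric_proj (C 0) y0.

Section Step.
Context (h : R) (h_gt0 : 0 < h) (h_lt : h < r).
Notation x := (catching_up h).

Let time_step k : k.+1%:R * h - k%:R * h = h.
Proof. by rewrite -mulrBl -natrB// subSnn mul1r. Qed.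

Let time_ge0 k : 0 <= k%:R * h.
Proof. by rewrite mulr_ge0// ltW. Qed.

Let time_le k : k%:R * h <= k.+1%:R * h.
Proof. by rewrite -subr_ge0 time_step ltW. Qed.

Lemma catching_up_in k : C (k%:R * h) (x k).
Proof.
elim: k => [|k IH].
  have := metric_projP (prox_regular_Proj (Cr (lexx 0)) y0r).
  by rewrite mul0r => -[].
have d := moving_dist (time_ge0 k) (time_le k) IH; rewrite time_step in d.
by have [] := metric_projP (prox_regular_Proj (Cr (time_ge0 k.+1)) (le_lt_trans d h_lt)).
Qed.

Lemma catching_up_Proj k : Proj (C (k.+1%:R * h)) (x k) (x k.+1).
Proof.
have d := moving_dist (time_ge0 k) (time_le k) (catching_up_in k); rewrite time_step in d.
exact: metric_projP (prox_regular_Proj (Cr (time_ge0 k.+1)) (le_lt_trans d h_lt)).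
Qed.

Lemma catching_up_step k : `|x k - x k.+1| <= h.
Proof.
rewrite (Proj_dist (catching_up_Proj k)) -[leRHS](time_step k).
exact: moving_dist (catching_up_in k).
Qed.

Lemma catching_up_drift i j : (i <= j)%N -> `|x j - x i| <= (j%:R - i%:R) * h.
Proof.
elim: j => [|j IH]; first by rewrite leqn0 => /eqP->; rewrite !subrr mul0r normr0.
rewrite leq_eqVlt => /predU1P[->|/IH {}IH]; first by rewrite !subrr mul0r normr0.
rewrite -(subrK (x j) (x j.+1)) -addrA; apply: (le_trans (ler_normD _ _)).
have := catching_up_step j; rewrite distrC => st.
rewrite -natr1; lra.
Qed.

(** The step is normal to the set at the new time, and [p] is within
    [k.+1%:R * h - s] of a point of that set by the excess bound.  Both errors
    are of second order when [h] and the elapsed time are small. *)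
Lemma catching_up_normal k (s : R) (p : H) : 0 <= s -> s <= k.+1%:R * h ->
  k.+1%:R * h - s < r -> C s p ->
  inner (x k - x k.+1) (p - x k.+1) <=
    h * ((k.+1%:R * h - s) + (`|p - x k.+1| + (k.+1%:R * h - s)) ^+ 2 / (2 * r)).
Proof.
move=> s0; set D := k.+1%:R * h - s => st Dr Cp.
have D0 : 0 <= D by rewrite subr_ge0.
have [c Cc pc] := moving_point s0 st Dr Cp.
have N : normal_cone (C (k.+1%:R * h)) (x k.+1) (x k - x k.+1).
  by exists 1, (x k); split => //; [exact: catching_up_Proj|rewrite scale1r].
have n1 := prox_regular_normal inner_norm r_gt0 (Cr (time_ge0 k.+1)) N Cc.
have -> : p - x k.+1 = (c - x k.+1) + (p - c) by rewrite [RHS]addrC subrKA.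
have st1 := catching_up_step k.
have n2 : inner (x k - x k.+1) (p - c) <= h * D.
  apply: (le_trans (inner_le inner_norm _ _)).
  by apply: ler_pM.
have cx : `|c - x k.+1| <= `|(c - x k.+1) + (p - c)| + D.
  have -> : c - x k.+1 = ((c - x k.+1) + (p - c)) - (p - c) by rewrite addrK.
  by apply: (le_trans (ler_normB _ _)); rewrite addrK lerD2l.
set q := `|_ + (p - c)| in cx *.
rewrite (innerDr inner) mulrDr addrC; apply: lerD => //.
apply: (le_trans n1); rewrite mulrAC [leRHS]mulrA; apply: ler_wpM2r.
  by rewrite invr_ge0; lra.
apply: ler_pM => //.
have q0 : 0 <= q by exact: normr_ge0.
by rewrite ler_pXn2r ?nnegrE // addr_ge0.
Qed.

End Step.

(** Strong convexity of the square; the quadratic gain [|w|^2] is dropped. *)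
Lemma sqr_increment_le (p q w : H) : p = q - w ->
  `|p| ^+ 2 - `|q| ^+ 2 <= - 2 * inner w p.
Proof.
move=> E; have -> : q = p + w by rewrite E subrK.
have := sqr_ge0 `|w|; rewrite (sqr_normD inner_norm p) (innerC inner w p); lra.
Qed.

Section Refinement.
Context (h h' : R) (N : nat) (h'_gt0 : 0 < h') (h_lt : h < r) (N_gt0 : (0 < N)%N)
  (hE : h = N%:R * h').
Notation x := (catching_up h).
Notation z := (catching_up h').

Let h_gt0 : 0 < h.
Proof. by rewrite hE mulr_gt0// ltr0n. Qed.

Let h'_le : h' <= h.
Proof. by rewrite hE ler_peMl ?ler1n// ltW. Qed.

Let h'_lt : h' < r.
Proof. exact: le_lt_trans h_lt. Qed.

(** The total displacement of the fine run during one coarse step is tested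
    against the final gap between the runs.  Each fine step is tested at the
    initial coarse position [x k], which belongs to an earlier set; the final gap
    differs from this test by displacements of size [O(h)]. *)
Lemma refinement_inner k i : (i <= N)%N ->
  inner (z (N * k)%N - z (N * k + i)%N) (x k.+1 - z (N * k + N)%N) <=
    i%:R * h' * (3 * h + (`|z (N * k)%N - x k| + 2 * h) ^+ 2 / (2 * r)).
Proof.
set d := x k.+1 - _; set a := `|_|.
elim: i => [|i IH] iN.
  by rewrite addn0 subrr !mul0r -(scale0r 0) (innerZl inner) mul0r.
have tE : (N * k + i).+1%:R * h' - k%:R * h = i.+1%:R * h'.
  by rewrite hE -addnS natrD natrM; ring.
have iN' : i.+1%:R * h' <= h by rewrite hE ler_pM2r// ler_nat.
have i0 : 0 < i.+1%:R * h' by rewrite mulr_gt0.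
have kh : 0 <= k%:R * h by rewrite mulr_ge0// ltW.
have n1 := @catching_up_normal h' h'_gt0 h'_lt (N * k + i)%N (k%:R * h) (x k) kh.
have kt : k%:R * h <= (N * k + i).+1%:R * h' by rewrite -subr_ge0 tE ltW.
rewrite tE in n1.
have {}n1 := n1 kt (le_lt_trans iN' h_lt) (catching_up_in h_gt0 h_lt k).
have st := catching_up_step h'_gt0 h'_lt (N * k + i)%N.
set w := z (N * k + i)%N - z (N * k + i).+1 in n1 st *.
have dr i1 j : (i1 <= j)%N -> (j <= N)%N -> `|z (N * k + j)%N - z (N * k + i1)%N| <= h.
  move=> ij jN; apply: (le_trans (catching_up_drift h'_gt0 h'_lt _)); first by rewrite leq_add2l.
  rewrite !natrD hE ler_pM2r//.
  have : j%:R <= N%:R :> R by rewrite ler_nat.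
  have := ler0n R i1; lra.
have xz : `|x k - z (N * k + i).+1| <= a + h.
  have -> : x k - z (N * k + i).+1 = (x k - z (N * k)%N) + (z (N * k)%N - z (N * k + i).+1).
    by rewrite addrA subrK.
  apply: (le_trans (ler_normD _ _)); rewrite distrC lerD2l distrC.
  by have := dr 0%N i.+1 (leq0n _) iN; rewrite addn0 addnS.
have n2 : inner w ((x k.+1 - x k) + (z (N * k + i).+1 - z (N * k + N)%N)) <= h' * (2 * h).
  apply: (le_trans (inner_le inner_norm _ _)); apply: ler_pM => //.
  apply: (le_trans (ler_normD _ _)).
  have := catching_up_step h_gt0 h_lt k; rewrite distrC => s1.
  have := dr i.+1 N iN (leqnn N); rewrite addnS distrC => s2; lra.
have E : d = (x k - z (N * k + i).+1) + ((x k.+1 - x k) + (z (N * k + i).+1 - z (N * k + N)%N)).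
  by rewrite /d [RHS]addrCA !subrKA.
have -> : z (N * k)%N - z (N * k + i.+1)%N = (z (N * k)%N - z (N * k + i)%N) + w.
  by rewrite /w addnS addrA subrK.
rewrite (innerDl inner) -natr1 mulrDl mul1r mulrDl.
apply: lerD; first exact/IH/ltnW.
rewrite E (innerDr inner).
have a0 : 0 <= a by exact: normr_ge0.
have p0 : 0 <= `|x k - z (N * k + i).+1| by exact: normr_ge0.
apply: (le_trans (lerD n1 n2)); rewrite -mulrDr ler_pM2l//.
have sq : (`|x k - z (N * k + i).+1| + i.+1%:R * h') ^+ 2 <= (a + 2 * h) ^+ 2.
  rewrite ler_pXn2r// ?nnegrE; lra.
have : (`|x k - z (N * k + i).+1| + i.+1%:R * h') ^+ 2 / (2 * r) <= (a + 2 * h) ^+ 2 / (2 * r).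
  by apply: ler_wpM2r => //; rewrite invr_ge0 mulr_ge0// ltW.
lra.
Qed.

(** One Gronwall step.  The coarse displacement is tested at the final fine
    position, which is in the same set, and the fine displacements by
    [refinement_inner]; the numerical constants only use [h <= r]. *)
Lemma refinement_step k :
  `|z (N * k.+1)%N - x k.+1| ^+ 2 <=
    (1 + 4 / r * h) * `|z (N * k)%N - x k| ^+ 2 + 22 * h ^+ 2.
Proof.
have [h0 r0 hr] := And3 h_gt0 r_gt0 h_lt.
have I := refinement_inner k (leqnn N); rewrite -hE in I.
rewrite mulnS addnC.
have zin : C (k.+1%:R * h) (z (N * k + N)%N).
  have := catching_up_in h'_gt0 h'_lt (N * k + N)%N.
  by rewrite -mulnSr natrM -mulrA (mulrC k.+1%:R) hE mulrC mulrA mulrCA mulrA.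
have k0 : 0 <= k.+1%:R * h by rewrite mulr_ge0// ltW.
have J := @catching_up_normal h h_gt0 h_lt k (k.+1%:R * h) _ k0 (lexx _) _ zin.
rewrite subrr addr0 add0r in J; have {}J := J r_gt0.
set a := `|z (N * k)%N - x k| in I *; set z' := z (N * k + N)%N in I J zin *.
have s1 := catching_up_step h_gt0 h_lt k.
have s2 : `|z (N * k)%N - z'| <= h.
  have := catching_up_drift h'_gt0 h'_lt (leq_addr N (N * k)%N).
  by rewrite distrC natrD addrAC subrr add0r -hE.
have E : z' - x k.+1 = (z (N * k)%N - x k) - ((z (N * k)%N - z') - (x k - x k.+1)).
  by rewrite [in RHS]opprB addrA subrKA opprB [RHS]addrC subrKA.
have a' : `|z' - x k.+1| <= a + 2 * h.
  rewrite E; apply: (le_trans (ler_normB _ _)); rewrite -/a lerD2l.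
  by apply: (le_trans (ler_normB _ _)); lra.
have := sqr_increment_le E; rewrite (innerBl inner).
have -> : inner (z (N * k)%N - z') (z' - x k.+1) = - inner (z (N * k)%N - z') (x k.+1 - z').
  by rewrite -(innerNr inner) opprB.
have a0 : 0 <= a by exact: normr_ge0.
have sq : `|z' - x k.+1| ^+ 2 / (2 * r) <= (a + 2 * h) ^+ 2 / (2 * r).
  apply: ler_wpM2r; first by rewrite invr_ge0 mulr_ge0// ltW.
  by rewrite ler_pXn2r ?nnegrE//; lra.
have {}J : inner (x k - x k.+1) (z' - x k.+1) <= h * ((a + 2 * h) ^+ 2 / (2 * r)).
  by apply: (le_trans J); rewrite ler_pM2l.
rewrite -/a => K.
have L : `|z' - x k.+1| ^+ 2 <= a ^+ 2 + 6 * h ^+ 2 + 4 * (h * ((a + 2 * h) ^+ 2 / (2 * r))).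
  by move: I J K; set T := _ / (2 * r); lra.
apply: (le_trans L).
have M : (a + 2 * h) ^+ 2 <= 2 * a ^+ 2 + 8 * h ^+ 2.
  by have := sqr_ge0 (a - 2 * h); lra.
have r2 : 0 <= (2 * r)^-1 by rewrite invr_ge0 mulr_ge0// ltW.
have P : 4 * (h * ((a + 2 * h) ^+ 2 / (2 * r))) <= 4 / r * h * a ^+ 2 + 16 * h ^+ 2 * (h / r).
  apply: (@le_trans _ _ (4 * (h * ((2 * a ^+ 2 + 8 * h ^+ 2) / (2 * r))))).
    by rewrite ler_pM2l// ler_pM2l// ler_wpM2r.
  rewrite le_eqVlt; apply/orP; left; apply/eqP; field; exact: lt0r_neq0.
have Q : h / r <= 1 by rewrite ler_pdivrMr// mul1r ltW.
have h2 : 0 <= h ^+ 2 by exact: sqr_ge0.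
nra.
Qed.

(** Discrete Gronwall estimate: the bound is of order [h] on bounded times,
    whatever the refinement [N], so the runs form a Cauchy sequence. *)
Lemma refinement_dist k :
  `|z (N * k)%N - x k| ^+ 2 <= 22 * h * (k%:R * h) * expR (4 / r * (k%:R * h)).
Proof.
have [h0 r0 hr] := And3 h_gt0 r_gt0 h_lt.
elim: k => [|k IH].
  by rewrite muln0 /= subrr normr0 expr0n mul0r mulr0 mul0r.
apply: (le_trans (refinement_step k)).
have c0 : 0 <= 4 / r * h by rewrite mulr_ge0 ?divr_ge0// ltW.
have E1 : 1 + 4 / r * h <= expR (4 / r * h) by exact: expR_ge1Dx.
have -> : 4 / r * (k.+1%:R * h) = 4 / r * h + 4 / r * (k%:R * h) by rewrite -natr1; ring.
rewrite expRD.
have E2 : 1 <= expR (4 / r * h) * expR (4 / r * (k%:R * h)).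
  have k0 : 0 <= k%:R * h by rewrite mulr_ge0// ltW.
  have r4 : 0 <= 4 / r by rewrite divr_ge0// ltW.
  rewrite -expRD; apply: le_trans (expR_ge1Dx _).
  by rewrite lerDl addr_ge0// mulr_ge0.
have : (1 + 4 / r * h) * `|z (N * k)%N - x k| ^+ 2 <=
    expR (4 / r * h) * (22 * h * (k%:R * h) * expR (4 / r * (k%:R * h))).
  by apply: ler_pM => //; lra.
have : 22 * h ^+ 2 <= 22 * h ^+ 2 * (expR (4 / r * h) * expR (4 / r * (k%:R * h))).
  by rewrite ler_peMr// mulr_ge0// sqr_ge0.
rewrite -natr1; lra.
Qed.

End Refinement.

End CatchingUp.

(** * The limit curve and its differential inclusion *)

Section Limit.
Context (R : realType) (H : completeNormedModType R) (inner : {dot H for idfun})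
  (inner_norm : forall x : H, inner x x = `|x| ^+ 2).
Context (r : R) (r_gt0 : 0 < r) (C : R -> set H) (y0 : H).
Context (Cr : prox_regular_map r C) (Ce : excess_1lipschitz C)
  (y0r : dist y0 (C 0) < r).

(** Dyadic fractions of [r], so that the grids are nested and every step is shorter
    than [r]. *)
Definition mesh (n : nat) : R := r / (2 ^ n.+1)%:R.

Lemma mesh_gt0 n : 0 < mesh n.
Proof. by rewrite divr_gt0// ltr0n expn_gt0. Qed.

Lemma mesh_lt n : mesh n < r.
Proof.
rewrite ltr_pdivrMr ?ltr0n ?expn_gt0// ltr_pMr// ltr1n.
by rewrite -{1}(expn0 2) ltn_exp2l.
Qed.

Lemma mesh_refine n m : (n <= m)%N -> mesh n = (2 ^ (m - n))%:R * mesh m.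
Proof.
move=> nm; rewrite /mesh -(subnK nm) addnK -addnS expnD natrM.
by field; rewrite !pnatr_eq0 !expn_eq0.
Qed.

Lemma mesh_small (e : R) : 0 < e -> \forall n \near \oo, mesh n < e.
Proof.
move=> e0; exists (Num.bound (r / e)) => // n /= bn.
rewrite /mesh ltr_pdivrMr ?ltr0n ?expn_gt0// mulrC -ltr_pdivrMr//.
apply: (lt_le_trans (archi_boundP _)); first by rewrite divr_ge0// ltW.
rewrite ler_nat (leq_trans bn)// ltnW// (leq_trans (ltnSn n))// ltnW//.
exact: ltn_expl.
Qed.

Lemma mesh_cvg0 : mesh n @[n --> \oo] --> (0 : R^o).
Proof.
apply/cvgrPdist_lt => e /mesh_small; apply: filterS => n.
by rewrite sub0r normrN gtr0_norm ?mesh_gt0.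
Qed.

Definition node (n : nat) (t : R) : nat := Num.truncn (t / mesh n).

Lemma node_le n t : 0 <= t -> (node n t)%:R * mesh n <= t.
Proof.
move=> t0; have h0 := mesh_gt0 n; rewrite -ler_pdivlMr//.
by have /truncn_itv /andP[] : 0 <= t / mesh n by rewrite divr_ge0// ltW.
Qed.

Lemma node_gt n t : 0 <= t -> t < (node n t).+1%:R * mesh n.
Proof.
move=> t0; have h0 := mesh_gt0 n; rewrite -ltr_pdivrMr//.
by have /truncn_itv /andP[] : 0 <= t / mesh n by rewrite divr_ge0// ltW.
Qed.

Lemma node_mono n s t : 0 <= s -> s <= t -> (node n s <= node n t)%N.
Proof.
move=> s0 st; rewrite -ltnS -(ltr_nat R) -(ltr_pM2r (mesh_gt0 n)).
exact: le_lt_trans (node_le n s0) (le_lt_trans st (node_gt n (le_trans s0 st))).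
Qed.

Definition approx (n : nat) (t : R) : H := catching_up C y0 (mesh n) (node n t).

(** The error splits into the displacement of the fine run since the last coarse
    node, at most [mesh n], and the distance [q] between the runs at that
    node. *)
Lemma approx_dist n m t : 0 <= t -> (n <= m)%N -> exists2 q : R,
  q ^+ 2 <= mesh n * (22 * t * expR (4 / r * t)) /\ 0 <= q &
  `|approx m t - approx n t| <= mesh n + q.
Proof.
move=> t0 nm; pose N := (2 ^ (m - n))%N.
have N0 : (0 < N)%N by rewrite expn_gt0.
have hE : mesh n = N%:R * mesh m := mesh_refine nm.
have hm := mesh_gt0 m; have hn := mesh_gt0 n.
pose z := catching_up C y0 (mesh m).
exists `|z (N * node n t)%N - approx n t|.
  split => //; apply: (le_trans (refinement_dist inner_norm r_gt0 Cr Ce y0r hm (mesh_lt n) N0 hE (node n t))).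
  have kt := node_le n t0; have k0 : 0 <= (node n t)%:R * mesh n by rewrite mulr_ge0// ltW.
  have r4 : 0 <= 4 / r by rewrite divr_ge0// ltW.
  have -> : mesh n * (22 * t * expR (4 / r * t)) = 22 * mesh n * t * expR (4 / r * t) by ring.
  apply: ler_pM => //; first by rewrite !mulr_ge0// ltW.
  by rewrite ler_wpM2l// mulr_ge0// ltW.
  by rewrite ler_expR ler_wpM2l.
have lo : (N * node n t <= node m t)%N.
  rewrite -ltnS -(ltr_nat R) -(ltr_pM2r hm) natrM -mulrA mulrCA -hE.
  exact: le_lt_trans (node_le n t0) (node_gt m t0).
have hi : (node m t <= N * node n t + N)%N.
  rewrite -mulnSr -(ler_nat R) -(ler_pM2r hm) natrM -mulrA [leRHS]mulrCA -hE.
  exact: ltW (le_lt_trans (node_le m t0) (node_gt n t0)).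
rewrite -(subrK (z (N * node n t)%N) (approx m t)) -addrA.
apply: (le_trans (ler_normD _ _)); rewrite lerD2r.
apply: (le_trans (catching_up_drift Cr Ce y0r hm (mesh_lt m) lo)).
rewrite hE ler_pM2r// lerBlDr -natrD ler_nat addnC.
exact: hi.
Qed.

Lemma approx_is_cvg t : 0 <= t -> cvg (approx n t @[n --> \oo]).
Proof.
move=> t0; apply: cauchy_cvg; apply: cauchy_exP => e e0.
pose Q := 22 * t * expR (4 / r * t).
have Q0 : 0 <= Q by rewrite !mulr_ge0// expR_ge0.
have e1 : 0 < Num.min (e / 2) ((e / 2) ^+ 2 / (Q + 1)).
  by rewrite lt_min !divr_gt0// ?exprn_gt0 ?divr_gt0//; lra.
have [n0 _ sm] := mesh_small e1.
exists (approx n0 t); exists n0 => // m /= nm.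
have [q [q2 q0] Hq] := approx_dist t0 nm.
have := sm n0 (leqnn n0); rewrite lt_min => /andP[s1 s2].
rewrite -ball_normE/= distrC; apply: (le_lt_trans Hq).
have : q < e / 2.
  rewrite -(ltr_pXn2r (_ : (0 < 2)%N)) ?nnegrE//; last lra.
  apply: (le_lt_trans q2); rewrite -/Q.
  move: s2; rewrite ltr_pdivlMr; last lra.
  have := mesh_gt0 n0; nra.
lra.
Qed.

(** Frozen at its initial value for negative times, which makes it Lipschitz on
    the whole line. *)
Definition sweep (t : R) : H := lim (approx n (Num.max 0 t) @[n --> \oo]).

Lemma sweep_cvg t : 0 <= t -> approx n t @[n --> \oo] --> sweep t.
Proof. by move=> t0; rewrite /sweep (max_idPr t0); exact: approx_is_cvg. Qed.

Lemma sweep_approx t e : 0 <= t -> 0 < e ->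
  \forall n \near \oo, `|sweep t - approx n t| <= e.
Proof. by move=> t0 e0; have /cvgrPdist_le := sweep_cvg t0; exact. Qed.

Lemma sweep0 : sweep 0 = metric_proj (C 0) y0.
Proof.
have := sweep_cvg (lexx 0).
have -> : (approx ^~ 0) = cst (metric_proj (C 0) y0).
  apply/funext => n; rewrite /approx (_ : node n 0 = 0%N)//.
  by rewrite /node mul0r; exact: (truncn_def (n := 0)) (introT andP (conj (lexx 0) ltr01)).
by move=> /(cvg_lim (@norm_hausdorff _ H)) <-; rewrite lim_cst.
Qed.

Lemma sweep_lipschitz_ge0 s t : 0 <= s -> s <= t -> `|sweep t - sweep s| <= t - s.
Proof.
move=> s0 st; have t0 := le_trans s0 st.
apply/ler_addgt0Pr => e e0; have e3 : 0 < e / 3 by lra.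
near \oo => n.
have at_ : `|sweep t - approx n t| <= e / 3 by near: n; exact: sweep_approx.
have as_ : `|sweep s - approx n s| <= e / 3 by near: n; exact: sweep_approx.
have hn : mesh n < e / 3 by near: n; exact: mesh_small.
have d := catching_up_drift Cr Ce y0r (mesh_gt0 n) (mesh_lt n) (node_mono n s0 st).
have -> : sweep t - sweep s = (sweep t - approx n t) + (approx n t - approx n s) + - (sweep s - approx n s).
  by rewrite opprB !addrA subrK subrK.
have n1 := ler_normD ((sweep t - approx n t) + (approx n t - approx n s)) (- (sweep s - approx n s)).
have n2 := ler_normD (sweep t - approx n t) (approx n t - approx n s).
rewrite normrN in n1.
have k1 := node_le n t0; have k2 := node_gt n s0; rewrite -natr1 in k2.
rewrite -/(approx n t) -/(approx n s) in d; lra.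
Unshelve. all: by end_near. Qed.

Lemma sweep_lipschitz s t : `|sweep s - sweep t| <= `|s - t|.
Proof.
have E u : sweep u = sweep (Num.max 0 u) by rewrite /sweep maxA maxxx.
have M (u : R) : 0 <= Num.max 0 u by rewrite le_max lexx.
wlog st : s t / s <= t.
  move=> W; have [/W//|/ltW/W] := leP s t.
  by rewrite distrC (distrC t).
rewrite distrC (distrC s) (ger0_norm (_ : 0 <= t - s)) ?subr_ge0//.
rewrite (E s) (E t); have mm : Num.max 0 s <= Num.max 0 t by rewrite ge_max !le_max lexx st orbT.
apply: (le_trans (sweep_lipschitz_ge0 (M s) mm)).
by rewrite /Num.max; case: ltP => s0; case: ltP => t0; lra.
Qed.

(** The approximation at [t] is in the set at the last node before [t], so
    the excess bound, used forward in time, puts it within [mesh n] of [C t]. *)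
Lemma sweep_in t : 0 <= t -> C t (sweep t).
Proof.
move=> t0; have [C0 cC _] := Cr t0.
apply: dist_eq0 => //; apply/ler_addgt0Pr => e e0; rewrite add0r.
have e2 : 0 < e / 2 by lra.
near \oo => n.
have at_ : `|sweep t - approx n t| <= e / 2 by near: n; exact: sweep_approx.
have hn : mesh n < e / 2 by near: n; exact: mesh_small.
have h0 := mesh_gt0 n.
have k0 : 0 <= (node n t)%:R * mesh n by rewrite mulr_ge0// ltW.
have k1 := node_le n t0; have k2 := node_gt n t0; rewrite -natr1 in k2.
have tr : t - (node n t)%:R * mesh n < r by have := mesh_lt n; lra.
have [c Cc pc] := moving_point Cr Ce k0 k1 tr (catching_up_in Cr Ce y0r h0 (mesh_lt n) (node n t)).
apply: (le_trans (dist_le _ Cc)).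
rewrite -(subrK (approx n t) (sweep t)) -addrA; apply: (le_trans (ler_normD _ _)).
rewrite -/(approx n t) in pc; lra.
Unshelve. all: by end_near. Qed.

(** Sum of [catching_up_normal] over the nodes between [s] and [t]; the point [p]
    is at distance at most [`|p - approx n s| + (t - s) + mesh n] from all the
    positions involved. *)
Lemma approx_evolution n s t p : 0 <= s -> s <= t -> t - s < r -> C s p ->
  `|p - approx n t| ^+ 2 - `|p - approx n s| ^+ 2 <=
    2 * (t - s + mesh n) *
    (t - s + (`|p - approx n s| + 2 * (t - s) + mesh n) ^+ 2 / (2 * r)).
Proof.
move=> s0 st tsr Cp; have t0 := le_trans s0 st.
set D := t - s; set a := `|p - approx n s|; set h := mesh n.
have h0 : 0 < h := mesh_gt0 n.
pose x := catching_up C y0 h; pose i := node n s; pose j := node n t.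
pose B := D + (a + 2 * D + h) ^+ 2 / (2 * r); rewrite -/B; have D0 : 0 <= D by rewrite subr_ge0.
have a0 : 0 <= a by exact: normr_ge0.
have r2 : 0 <= (2 * r)^-1 by rewrite invr_ge0 mulr_ge0// ltW.
have B0 : 0 <= B by rewrite addr_ge0// mulr_ge0// sqr_ge0.
have si := node_gt n s0; rewrite -/i -/h in si.
have tj := node_le n t0; rewrite -/j -/h in tj.
have ij : (i <= j)%N := node_mono n s0 st.
suff step m : (i <= m)%N -> (m <= j)%N ->
    `|p - x m| ^+ 2 - a ^+ 2 <= 2 * ((m%:R - i%:R) * h) * B.
  apply: (le_trans (step j ij (leqnn j))); rewrite ler_wpM2r// ler_pM2l//.
  by rewrite -natr1 in si; rewrite /D; lra.
elim: m => [|m IH].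
  by rewrite leqn0 => /eqP i0; rewrite /a /approx -/i i0 !subrr mul0r mulr0 mul0r.
rewrite leq_eqVlt => /predU1P[<- _|].
  by rewrite /a /approx -/i -/x !subrr mul0r mulr0 mul0r.
rewrite ltnS => im mj; have {}IH := IH im (ltnW mj).
have m1 : s <= m.+1%:R * h.
  apply: (le_trans (ltW si)); rewrite ler_pM2r// ler_nat ltnS//.
have m2 : m.+1%:R * h <= t by apply: le_trans tj; rewrite ler_pM2r// ler_nat.
have m3 : m.+1%:R * h - s < r by apply: le_lt_trans tsr; rewrite lerB.
have N := catching_up_normal inner_norm r_gt0 Cr Ce y0r h0 (mesh_lt n) s0 m1 m3 Cp.
have dr : `|x m.+1 - x i| <= D + h.
  apply: (le_trans (catching_up_drift Cr Ce y0r h0 (mesh_lt n) (leqW im))).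
  by rewrite -natr1 in si; rewrite /D; lra.
have px : `|p - x m.+1| <= a + (D + h).
  have -> : p - x m.+1 = (p - x i) - (x m.+1 - x i) by rewrite opprB subrKA.
  by apply: (le_trans (ler_normB _ _)); rewrite lerD2l.
have sq : (`|p - x m.+1| + (m.+1%:R * h - s)) ^+ 2 / (2 * r) <=
    (a + 2 * D + h) ^+ 2 / (2 * r).
  apply: ler_wpM2r => //; have q0 := normr_ge0 (p - x m.+1).
  by rewrite ler_pXn2r ?nnegrE//; rewrite /D in px *; lra.
have E : p - x m.+1 = (p - x m) - (x m.+1 - x m) by rewrite opprB subrKA.
have := sqr_increment_le inner_norm E.
rewrite -(opprB (x m) (x m.+1)) (innerNl inner).
have N' : inner (x m - x m.+1) (p - x m.+1) <= h * B.
  apply: (le_trans N); rewrite ler_pM2l// /B; apply: lerD => //.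
  by rewrite /D; lra.
rewrite -natr1; lra.
Qed.

Lemma sweep_evolution s t p : 0 <= s -> s <= t -> t - s < r -> C s p ->
  `|p - sweep t| ^+ 2 - `|p - sweep s| ^+ 2 <=
    2 * (t - s) * (t - s + (`|p - sweep s| + 2 * (t - s)) ^+ 2 / (2 * r)).
Proof.
move=> s0 st tsr Cp; have t0 := le_trans s0 st.
have cn u : 0 <= u -> `|p - approx n u| @[n --> \oo] --> (`|p - sweep u| : R^o).
  by move=> u0; apply: cvg_norm; apply: cvgB; [exact: cvg_cst|exact: sweep_cvg].
have c2 u : 0 <= u -> `|p - approx n u| ^+ 2 @[n --> \oo] --> (`|p - sweep u| ^+ 2 : R^o).
  by move=> u0; under eq_fun do rewrite expr2; rewrite expr2; apply: cvgM; exact: cn.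
apply: (@ler_cvg_to _ \oo _ R (fun n => `|p - approx n t| ^+ 2 - `|p - approx n s| ^+ 2)
  (fun n => 2 * (t - s + mesh n) *
    (t - s + (`|p - approx n s| + 2 * (t - s) + mesh n) ^+ 2 / (2 * r)))).
- exact: (@cvgB _ R^o _ _ _ _ _ _ _ (c2 t t0) (c2 s s0)).
- have cA : t - s + mesh n @[n --> \oo] --> (t - s : R^o).
    rewrite -[X in _ --> X]addr0; apply: (@cvgD _ R^o); first exact: cvg_cst.
    exact: mesh_cvg0.
  have cB : `|p - approx n s| + 2 * (t - s) + mesh n @[n --> \oo] -->
      (`|p - sweep s| + 2 * (t - s) : R^o).
    rewrite -[X in _ --> X]addr0; apply: (@cvgD _ R^o); last exact: mesh_cvg0.
    by apply: (@cvgD _ R^o); [exact: cn|exact: cvg_cst].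
  apply: cvgM; first by apply: cvgM; [exact: cvg_cst|exact: cA].
  apply: (@cvgD _ R^o); first exact: cvg_cst.
  apply: cvgM; last exact: cvg_cst.
  by under eq_fun do rewrite expr2; rewrite expr2; apply: cvgM.
- by apply: nearW => n; exact: approx_evolution.
Qed.

(** At [t + m] the inequality of [sweep_evolution], divided by [2 m], reads
    [<- w, c - x> <= |c - x|^2 / (2 r) + O(m)] where [w] is the derivative; [m]
    tends to zero and [normal_cone_of_le] applies. *)
Lemma sweep_normal t : 0 <= t -> derivable sweep t 1 ->
  normal_cone (C t) (sweep t) (- derive1 sweep t).
Proof.
move=> t0 dt; apply: (normal_cone_of_le inner_norm r_gt0 (sweep_in t0)) => c Cc.
have r0 := r_gt0.
set w := derive1 _ _; set x := sweep t; pose a := `|c - x|.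
have a0 : 0 <= a by exact: normr_ge0.
(* [K] collects the error terms: with [m] below [e / K], they sum to at most [e]. *)
pose K := 1 + a + (2 * a + 2) / r.
have K0 : 0 < K by rewrite ltr_wpDr ?divr_ge0//; lra.
apply/ler_addgt0Pr => e e0.
have eK : 0 < e / K by rewrite divr_gt0.
have [d d0 Hd] := derivable_expansion dt eK.
pose m := Num.min (Num.min 1 (e / K)) (Num.min (r / 2) (d / 2)).
have m0 : 0 < m by rewrite !lt_min ltr01 eK !divr_gt0.
have m1 : m <= 1 by rewrite !ge_min lexx.
have m2 : m <= e / K by rewrite !ge_min lexx orbT.
have m3 : m <= r / 2 by rewrite !ge_min lexx !orbT.
have m4 : m <= d / 2 by rewrite !ge_min lexx !orbT.
have := Hd m; rewrite gtr0_norm// => /(_ ltac:(lra)); set rho := _ - m *: _ => hrho.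
have tm : t <= t + m by lra.
have := sweep_evolution t0 tm ltac:(lra) Cc.
rewrite (_ : t + m - t = m); last lra.
have -> : c - sweep (t + m) = (c - x) - (m *: w + rho).
  have -> : m *: w + rho = sweep (t + m) - x by rewrite addrC subrK.
  by rewrite opprB subrKA.
rewrite (sqr_normB inner_norm (c - x)) -/x -/a.
rewrite (innerC inner (c - x)) (innerDl inner) (innerZl inner) (innerNl inner).
have ir : inner rho (c - x) <= e / K * m * a.
  by apply: (le_trans (inner_le inner_norm _ _)); rewrite ler_wpM2r.
move=> ev.
have {}ev : - inner w (c - x) <= m + (a + 2 * m) ^+ 2 / (2 * r) + e / K * a.
  rewrite -(ler_pM2l m0); have := sqr_ge0 `|m *: w + rho|; lra.
have E : (a + 2 * m) ^+ 2 / (2 * r) = a ^+ 2 / (2 * r) + m * (2 * a + 2 * m) / r.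
  by field; rewrite gt_eqF.
have F : m * (2 * a + 2 * m) / r <= e / K * ((2 * a + 2) / r).
  rewrite mulrA ler_wpM2r ?invr_ge0 ?(ltW r0)//.
  by apply: ler_pM => //; lra.
have G : e / K * K = e by rewrite divfK// gt_eqF.
rewrite /K 2!mulrDr mulr1 -/K in G; lra.
Qed.

End Limit.

(** * Absolutely continuous curves *)

Section AbsoluteContinuity.
Context (R : realType).
Notation mu := (@lebesgue_measure R).

Lemma loc_abs_cont_dominated (V W : normedModType R) (z : R -> V) (f : R -> W) :
  loc_abs_cont z ->
  (forall T : R, exists2 k, 0 <= k & forall s t, 0 <= s -> s <= t -> t <= T ->
     `|f t - f s| <= k * (`|z t - z s| + (t - s))) ->
  loc_abs_cont f.
Proof.
move=> acz fz T e e0; have [k k0 kP] := fz T.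
pose e1 := e / (2 * (k + 1)).
have k1 : 0 < 2 * (k + 1) by lra.
have e10 : 0 < e1 by rewrite divr_gt0.
have [d d0 acd] := acz T e1 e10.
exists (Num.min d e1); first by rewrite lt_min d0.
move=> n a b ab tI; rewrite lt_min => /andP[sd se].
have S : \sum_(0 <= i < n) `|f (b i) - f (a i)| <=
    k * (\sum_(0 <= i < n) `|z (b i) - z (a i)| + \sum_(0 <= i < n) (b i - a i)).
  rewrite -big_split/= mulr_sumr; apply: ler_sum_nat => i /andP[_ ni].
  by have [a0 aib bT] := ab i ni; exact: kP.
apply: (le_lt_trans S); have sz := acd n a b ab tI sd.
apply: (@le_lt_trans _ _ (k * (e1 + e1))).
  by rewrite ler_wpM2l// lerD// ltW.
have -> : e = 2 * (k + 1) * e1 by rewrite /e1 mulrC divfK// gt_eqF.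
nra.
Qed.

Lemma loc_lipschitz_abs_cont (W : normedModType R) (f : R -> W) :
  (forall T : R, exists2 k, 0 <= k & forall s t, 0 <= s -> s <= t -> t <= T ->
     `|f t - f s| <= k * (t - s)) ->
  loc_abs_cont f.
Proof.
move=> fl; apply: (@loc_abs_cont_dominated R^o W (fun=> 0)).
  move=> T e e0; exists 1 => // n a b _ _ _.
  by rewrite big1// => i _; rewrite subrr normr0.
move=> T; have [k k0 kP] := fl T; exists k => // s t s0 st tT.
by rewrite subrr normr0 add0r; exact: kP.
Qed.

Lemma ac_derive_le0_nonincreasing (f : R -> R) :
  @loc_abs_cont R R^o f ->
  {ae mu, forall t, 0 <= t -> derivable (f : R -> R^o) t 1 /\ derive1 (f : R -> R^o) t <= 0} ->
  forall a b, 0 <= a -> a <= b -> f b <= f a.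
Proof.
move=> acf df; apply: (ac_nonincreasing acf df) => t t0 /contrapT /(_ t0)[dt D0] e e0.
have [d d0 H] := derivable_expansion dt e0.
have {D0 H} [D D0 H] : exists2 D : R, D <= 0 & forall h, `|h| < d ->
    `|f (t + h) - f t - h * D| <= e * `|h| by exists (derive1 (f : R -> R^o) t).
exists d => // u v u0 /andP[ut tv] du vd.
have := H (v - t); rewrite ger0_norm ?subr_ge0// => /(_ ltac:(lra)).
have := H (u - t); rewrite ler0_norm ?subr_le0// => /(_ ltac:(lra)).
rewrite ![_ + (_ - t)]addrC !subrK !ler_norml => /andP[h1 h2] /andP[h3 h4].
have p1 : (v - t) * D <= 0 by rewrite mulr_ge0_le0 ?subr_ge0.
have p2 : 0 <= (u - t) * D by rewrite mulr_le0 ?subr_le0.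
lra.
Qed.

End AbsoluteContinuity.

(** * Speed of solutions *)

Section Uniqueness.
Context (R : realType) (H : normedModType R) (inner : {dot H for idfun})
  (inner_norm : forall x : H, inner x x = `|x| ^+ 2).
Context (r : R) (r_gt0 : 0 < r) (C : R -> set H)
  (Cr : prox_regular_map r C) (Ce : excess_1lipschitz C).
Notation mu := (@lebesgue_measure R).

Lemma derivable_inner (z : R -> H) (c : H) t : derivable z t 1 ->
  derivable (fun s => inner (z s) c : R^o) t 1 /\
  derive1 (fun s => inner (z s) c : R^o) t = inner (derive1 z t) c.
Proof.
move=> dz; apply: expansion_derivable => e e0.
have c0 : 0 < `|c| + 1 by rewrite ltr_wpDl.
have [d d0 Hd] := derivable_expansion dz (divr_gt0 e0 c0).
exists d => // h /Hd hd.
have -> : inner (z (t + h)) c - inner (z t) c - h *: inner (derive1 z t) c =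
    inner (z (t + h) - z t - h *: derive1 z t) c.
  by rewrite !(innerBl inner) (innerZl inner).
apply: (le_trans (norm_inner_le inner_norm _ _)).
apply: (@le_trans _ _ (e / (`|c| + 1) * `|h| * `|c|)); first exact: ler_wpM2r.
have -> : e / (`|c| + 1) * `|h| * `|c| = e * `|h| * (`|c| / (`|c| + 1)) by ring.
by rewrite ler_piMr ?mulr_ge0 ?(ltW e0)// ler_pdivrMr// mul1r lerDl.
Qed.

(** The scalar function [<z, c> - t |c|], where [c] is the chord itself, has an
    almost everywhere nonpositive derivative. *)
Lemma abs_cont_speed_le1 (z : R -> H) : loc_abs_cont z ->
  {ae mu, forall t, 0 <= t -> derivable z t 1 /\ `|derive1 z t| <= 1} ->
  forall a b, 0 <= a -> a <= b -> `|z b - z a| <= b - a.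
Proof.
move=> acz dz a b a0 ab; pose c := z b - z a.
have [c0|c0] := eqVneq c 0; first by rewrite -/c c0 normr0 subr_ge0.
have nc : 0 < `|c| by rewrite normr_gt0.
pose f t := inner (z t) c - t * `|c|.
have : f b <= f a.
  apply: ac_derive_le0_nonincreasing => //.
    apply: (loc_abs_cont_dominated acz) => T; exists `|c| => // s t s0 st tT.
    have -> : f t - f s = inner (z t - z s) c - (t - s) * `|c|.
      by rewrite (innerBl inner) /f; ring.
    apply: (le_trans (ler_normB _ _)).
    rewrite [`|_ * `|c| |]normrM normr_id ger0_norm ?subr_ge0// mulrDr.
    rewrite [`|c| * (t - s)]mulrC lerD2r mulrC.
    exact: norm_inner_le.
  move: dz; apply: (@filterS _ _ (ae_filter_ringOfSetsType mu)) => t + t0.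
  move=> /(_ t0)[dz z1].
  have [di Di] := derivable_inner c dz.
  have [df ->] : derivable (f : R -> R^o) t 1 /\
      derive1 (f : R -> R^o) t = inner (derive1 z t) c - `|c|.
    apply: expansion_derivable => e e0.
    have [d d0 Hd] := derivable_expansion di e0.
    exists d => // h /Hd; rewrite Di.
    suff E : inner (z (t + h)) c - inner (z t) c - h * inner (derive1 z t) c =
        f (t + h) - f t - h * (inner (derive1 z t) c - `|c|).
      by rewrite [X in `|X| <= _ -> _]E.
    by rewrite /f; ring.
  split => //; rewrite subr_le0; apply: (le_trans (inner_le inner_norm _ _)).
  by rewrite ler_piMl.
rewrite /f => fba.
have : inner c c <= (b - a) * `|c| by rewrite {1}/c (innerBl inner); lra.
by rewrite inner_norm expr2 ler_pM2r.
Qed.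

(** For [m] small, [z (t - m)] is within [m] of a point [c] of [C t], by the
    excess bound.  The normal vector [- w] is almost nonpositive on [c - z t],
    which is [- m *: w] up to an error of norm about [m]; hence
    [m |w|^2 <= m |w| + o(m)]. *)
Lemma solution_speed (z : R -> H) t : 0 < t ->
  (forall s, 0 <= s -> C s (z s)) -> derivable z t 1 ->
  normal_cone (C t) (z t) (- derive1 z t) -> `|derive1 z t| <= 1.
Proof.
move=> t0 zC dz N; have r0 := r_gt0.
set w := derive1 z t in N *; set x := z t in N.
apply/ler_addgt0Pr => e e0.
have [->|w0] := eqVneq w 0; first by rewrite normr0; lra.
have nw : 0 < `|w| by rewrite normr_gt0.
pose q := Num.min 1 (e / 2).
have q0 : 0 < q by rewrite lt_min ltr01 divr_gt0.
have q1 : q <= 1 by rewrite ge_min lexx.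
have q2 : q <= e / 2 by rewrite ge_min lexx orbT.
have [d d0 Hd] := derivable_expansion dz q0.
pose B := (2 + `|w|) ^+ 2 / (2 * r).
have B0 : 0 < B by rewrite divr_gt0 ?exprn_gt0//; lra.
pose m := Num.min (Num.min (d / 2) t) (Num.min (r / 2) (e / 2 / B)).
have e2 : 0 < e / 2 by rewrite divr_gt0.
have m0 : 0 < m.
  by rewrite !lt_min t0 (divr_gt0 e2 B0) !divr_gt0.
have m1 : m <= d / 2 by rewrite !ge_min lexx.
have m2 : m <= t by rewrite !ge_min lexx orbT.
have m3 : m <= r / 2 by rewrite !ge_min lexx !orbT.
have m4 : m <= e / 2 / B by rewrite !ge_min lexx !orbT.
have := Hd (- m); rewrite normrN gtr0_norm// => /(_ ltac:(lra)).
rewrite scaleNr opprK -/w -/x; set rho := _ + m *: w => hrho.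
have s0 : 0 <= t - m by lra.
have [c Cc zc] := moving_point Cr Ce s0 (ltac:(lra) : t - m <= t) (ltac:(lra) : t - (t - m) < r) (zC _ s0).
have {}zc : `|z (t - m) - c| <= m by apply: (le_trans zc); lra.
have n1 := prox_regular_normal inner_norm r_gt0 (Cr (ltW t0)) N Cc.
have E : c - x = - (z (t - m) - c) + (rho - m *: w).
  by rewrite /rho addrK opprB subrKA.
have cx : `|c - x| <= m * (2 + `|w|).
  rewrite E; apply: (le_trans (ler_normD _ _)); rewrite normrN.
  apply: (le_trans (lerD zc (ler_normB _ _))); rewrite normrZ gtr0_norm//.
  have : q * m <= m by rewrite ler_piMl// ltW.
  lra.
have i1 : inner w (z (t - m) - c) >= - (`|w| * m).
  have := norm_inner_le inner_norm w (z (t - m) - c); rewrite ler_norml => /andP[h _].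
  by apply: le_trans h; rewrite lerN2 ler_wpM2l// ltW.
have i2 : inner w rho <= `|w| * (q * m).
  by apply: (le_trans (inner_le inner_norm _ _)); rewrite ler_wpM2l// ltW.
have i3 : `|w| / (2 * r) * `|c - x| ^+ 2 <= `|w| * (m ^+ 2 * B).
  have -> : m ^+ 2 * B = (m * (2 + `|w|)) ^+ 2 / (2 * r) by rewrite /B; ring.
  rewrite -mulrA ler_pM2l// mulrC ler_wpM2r//.
    by rewrite invr_ge0; lra.
  have p0 : 0 <= m * (2 + `|w|) by apply: mulr_ge0; lra.
  by rewrite ler_pXn2r ?nnegrE.
move: n1; rewrite normrN E (innerNl inner) (innerDr inner) (innerNr inner).
rewrite (innerBr inner w rho) (innerZr inner) inner_norm -E => n1.
have mB : m * B <= e / 2 by rewrite -ler_pdivlMr.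
have K : `|w| * m * `|w| <= `|w| * m * (1 + q + m * B).
  by have := le_trans n1 i3; lra.
by rewrite ler_pM2l ?mulr_gt0// in K; lra.
Qed.

End Uniqueness.

(** * Gronwall's lemma for the squared norm *)

Section Gronwall.
Context (R : realType) (H : normedModType R) (inner : {dot H for idfun})
  (inner_norm : forall x : H, inner x x = `|x| ^+ 2).
Notation mu := (@lebesgue_measure R).

Lemma derivable_sqr_norm (u : R -> H) t : derivable u t 1 ->
  derivable (fun s => `|u s| ^+ 2 : R^o) t 1 /\
  derive1 (fun s => `|u s| ^+ 2 : R^o) t = 2 * inner (derive1 u t) (u t).
Proof.
move=> du; apply: expansion_derivable => e e0.
set w := derive1 u t.
pose k := 2 * `|u t| + (`|w| + 1) ^+ 2 + 1.
have k0 : 0 < k by rewrite /k; have := sqr_ge0 (`|w| + 1); have := normr_ge0 (u t); lra.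
pose q := Num.min 1 (e / k).
have q0 : 0 < q by rewrite lt_min ltr01 divr_gt0.
have q1 : q <= 1 by rewrite ge_min lexx.
have qk : q * k <= e by rewrite -ler_pdivlMr// ge_min lexx orbT.
have [d d0 Hd] := derivable_expansion du q0.
exists (Num.min d q); first by rewrite lt_min d0.
move=> h; rewrite lt_min => /andP[hd hq].
have := Hd h hd; rewrite -/w; set rho := _ - h *: w => hrho.
have E : u (t + h) = u t + (h *: w + rho).
  by rewrite /rho [h *: w + _]addrC subrK [RHS]addrC subrK.
have n1 : `|h *: w + rho| <= `|h| * (`|w| + 1).
  apply: (le_trans (ler_normD _ _)); rewrite normrZ mulrDr lerD2l mulr1.
  by apply: (le_trans hrho); rewrite ler_piMl.
have n2 : `|h *: w + rho| ^+ 2 <= `|h| * q * (`|w| + 1) ^+ 2.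
  apply: (@le_trans _ _ ((`|h| * (`|w| + 1)) ^+ 2)).
    have p0 : 0 <= `|h| * (`|w| + 1) by rewrite mulr_ge0// addr_ge0.
    by rewrite ler_pXn2r ?nnegrE.
  rewrite exprMn ler_wpM2r ?sqr_ge0// expr2 ler_wpM2l// ltW//.
have n3 : `|inner (u t) rho| <= `|u t| * (q * `|h|).
  by apply: (le_trans (norm_inner_le inner_norm _ _)); rewrite ler_wpM2l.
suff S : `|u (t + h)| ^+ 2 - `|u t| ^+ 2 - h * (2 * inner w (u t)) =
    2 * inner (u t) rho + `|h *: w + rho| ^+ 2.
  rewrite [X in `|X| <= _]S; apply: (le_trans (ler_normD _ _)).
  rewrite [`|2 * _|]normrM (ger0_norm (ler0n R 2)) [X in _ + X]ger0_norm ?sqr_ge0//.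
  apply: (@le_trans _ _ (q * k * `|h|)); last by rewrite ler_wpM2r.
  have := mulr_ge0 (ltW q0) (normr_ge0 h); rewrite /k; lra.
rewrite E (sqr_normD inner_norm (u t)) (innerDr inner) (innerZr inner) (innerC inner w); ring.
Qed.

(** [expR (- k * s) * |u s|^2] is locally Lipschitz with an almost everywhere
    nonpositive derivative, and vanishes at [0]. *)
Lemma gronwall_eq0 (u : R -> H) (k : R) : 0 <= k -> u 0 = 0 ->
  (forall s t, 0 <= s -> s <= t -> `|u t - u s| <= 2 * (t - s)) ->
  {ae mu, forall t, 0 <= t -> derivable u t 1 /\
     2 * inner (derive1 u t) (u t) <= k * `|u t| ^+ 2} ->
  forall t, 0 <= t -> u t = 0.
Proof.
move=> k0 u0 ul du t t0.
pose E s := expR (- k * s); pose D s := `|u s| ^+ 2.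
have un s : 0 <= s -> `|u s| <= 2 * s.
  by move=> s0; have := ul 0 s (lexx 0) s0; rewrite u0 !subr0.
have : E t * D t <= E 0 * D 0.
  apply: (@ac_derive_le0_nonincreasing R (fun s => E s * D s)) => //.
    apply: loc_lipschitz_abs_cont => T.
    have [T0|T0] := ltP T 0; first by exists 0 => // a b a0 ab bT; exfalso; lra.
    exists (8 * T + k * (2 * T) ^+ 2).
      by rewrite addr_ge0 ?mulr_ge0// sqr_ge0.
    move=> a b a0 ab bT; have b0 := le_trans a0 ab.
    have Eb : `|E b| <= 1.
      by rewrite ger0_norm ?expR_ge0// -expR0 ler_expR mulNr oppr_le0 mulr_ge0.
    have Eab : `|E b - E a| <= k * (b - a).
      have -> : E b = E a * expR (- (k * (b - a))) by rewrite /E -expRD; congr expR; ring.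
      rewrite -{2}[E a]mulr1 -mulrBr normrM distrC.
      have x1 : expR (- (k * (b - a))) <= 1.
        by rewrite -expR0 ler_expR oppr_le0 mulr_ge0// subr_ge0.
      rewrite ger0_norm ?subr_ge0//; last by rewrite expR_ge0.
      rewrite [`|1 - _|]ger0_norm ?subr_ge0// -[leRHS]mul1r; apply: ler_pM.
      - by rewrite expR_ge0.
      - by rewrite subr_ge0.
      - by rewrite -expR0 ler_expR mulNr oppr_le0 mulr_ge0.
      - have := expR_ge1Dx (- (k * (b - a))); lra.
    have ua := un a a0; have ub := un b b0.
    have Dab : `|D b - D a| <= 8 * T * (b - a).
      rewrite /D subr_sqr normrM mulrC.
      apply: (@le_trans _ _ ((4 * T) * (2 * (b - a)))); last lra.
      apply: ler_pM => //.
        rewrite ger0_norm ?addr_ge0//; lra.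
      by apply: (le_trans (ler_dist_dist _ _)); exact: ul.
    have Da : `|D a| <= (2 * T) ^+ 2.
      rewrite /D ger0_norm ?sqr_ge0// ler_pXn2r ?nnegrE//; lra.
    have -> : E b * D b - E a * D a = E b * (D b - D a) + (E b - E a) * D a by ring.
    apply: (le_trans (ler_normD _ _)); rewrite [`|E b * _|]normrM [`|_ * D a|]normrM mulrDl; apply: lerD.
      by rewrite -[leRHS]mul1r; apply: ler_pM.
    by rewrite [leRHS]mulrAC; apply: ler_pM.
  move: du; apply: (@filterS _ _ (ae_filter_ringOfSetsType mu)) => s + s0.
  move=> /(_ s0)[ds ineq].
  have [dD DD] := derivable_sqr_norm ds.
  have dE : is_derive s 1 (E : R -> R^o) (- k * E s).
    have dl : is_derive s 1 ((fun x : R => - k * x) : R -> R^o) (- k).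
      have := @is_deriveZ _ _ _ (@id R^o) (- k) s 1 1 (is_derive_id _ _).
      by rewrite [_ *: 1]mulr1.
    have := is_derive1_comp (is_derive_expR (- k * s)) dl.
    by rewrite mulrC.
  have dDs : is_derive s 1 (D : R -> R^o) (2 * inner (derive1 u s) (u s)).
    by apply: DeriveDef => //; rewrite -derive1E.
  have dED : is_derive s 1 ((fun x => E x * D x) : R -> R^o)
      (E s *: (2 * inner (derive1 u s) (u s)) + D s *: (- k * E s)) := is_deriveM dE dDs.
  split; first exact: (@ex_derive _ _ _ _ _ _ _ dED).
  rewrite derive1E (@derive_val _ _ _ _ _ _ _ dED).
  rewrite [E s *: _]/(E s * _) [D s *: _]/(D s * _).
  have -> : E s * (2 * inner (derive1 u s) (u s)) + D s * (- k * E s) =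
      E s * (2 * inner (derive1 u s) (u s) - k * D s) by ring.
  by rewrite mulr_ge0_le0 ?expR_ge0// subr_le0.
rewrite {2}/D u0 normr0 expr0n mulr0 pmulr_rle0 ?expR_gt0// => Dt.
apply/eqP; rewrite -normr_eq0 -sqrf_eq0 eq_le Dt.
exact: sqr_ge0.
Qed.

End Gronwall.

(** * Well-posedness of the sweeping process *)

Section WellPosedness.
Context (R : realType) (H : normedModType R) (inner : {dot H for idfun})
  (inner_norm : forall x : H, inner x x = `|x| ^+ 2).
Context (r : R) (r_gt0 : 0 < r) (C : R -> set H)
  (Cr : prox_regular_map r C) (Ce : excess_1lipschitz C).
Notation mu := (@lebesgue_measure R).

Lemma ae_neq0 : {ae mu, forall t, t != 0}.
Proof.
exists [set 0]; split; first exact: measurable_set1.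
  exact: lebesgue_measure_set1.
by move=> t /= /negP; rewrite negbK => /eqP.
Qed.

Lemma solution_speed_ae (y0 : H) (z : R -> H) : sweeping_solution C y0 z ->
  {ae mu, forall t, 0 <= t -> [/\ derivable z t 1, `|derive1 z t| <= 1
    & normal_cone (C t) (z t) (- derive1 z t)]}.
Proof.
move=> [zC zd _]; move: zd ae_neq0.
apply: (@filterS2 _ _ (ae_filter_ringOfSetsType mu)) => t zd tn0 t0.
have [dz N] := zd t0; split => //.
by apply: (solution_speed inner_norm r_gt0 Cr Ce _ zC dz N); rewrite lt_neqAle eq_sym tn0.
Qed.

Lemma solution_lipschitz (y0 : H) (z : R -> H) :
  loc_abs_cont z -> sweeping_solution C y0 z ->
  forall a b, 0 <= a -> a <= b -> `|z b - z a| <= b - a.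
Proof.
move=> acz sz; apply: (abs_cont_speed_le1 inner_norm acz).
have := solution_speed_ae sz.
by apply: (@filterS _ _ (ae_filter_ringOfSetsType mu)) => t + t0 => /(_ t0)[].
Qed.

(** Hypomonotonicity of the truncated normal cone: the normal inequality is used at
    [x] tested at [y] and at [y] tested at [x], and the two are added. *)
Lemma normal_monotone t (x y v w : H) : 0 <= t -> C t x -> C t y ->
  normal_cone (C t) x (- v) -> normal_cone (C t) y (- w) ->
  `|v| <= 1 -> `|w| <= 1 ->
  2 * inner (v - w) (x - y) <= 2 / r * `|x - y| ^+ 2.
Proof.
move=> t0 Cx Cy Nx Ny v1 w1.
have n1 := prox_regular_normal inner_norm r_gt0 (Cr t0) Nx Cy.
have n2 := prox_regular_normal inner_norm r_gt0 (Cr t0) Ny Cx.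
have ir : 0 <= (2 * r)^-1 by rewrite invr_ge0 mulr_ge0// ltW.
have sq : 0 <= `|x - y| ^+ 2 by exact: sqr_ge0.
have b (a : H) : `|a| <= 1 -> `|- a| / (2 * r) * `|x - y| ^+ 2 <= (2 * r)^-1 * `|x - y| ^+ 2.
  by move=> a1; rewrite normrN ler_wpM2r// ler_piMl.
rewrite (distrC y) in n1.
have {}n1 := le_trans n1 (b v v1); have {}n2 := le_trans n2 (b w w1).
rewrite -(opprB x) (innerNl inner) (innerNr inner) opprK in n1.
rewrite (innerNl inner) in n2.
rewrite (innerBl inner).
have -> : 2 / r = 4 * (2 * r)^-1 by field; rewrite gt_eqF.
lra.
Qed.

Lemma sweeping_solution_unique (y0 : H) (y z : R -> H) :
  loc_abs_cont y -> sweeping_solution C y0 y ->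
  loc_abs_cont z -> sweeping_solution C y0 z ->
  forall t, 0 <= t -> z t = y t.
Proof.
move=> acy sy acz sz t t0.
have yl := solution_lipschitz acy sy; have zl := solution_lipschitz acz sz.
have [yC _ y00] := sy; have [zC _ z00] := sz.
apply/eqP; rewrite -subr_eq0; apply/eqP; move: t t0.
have k0 : 0 <= 2 / r by rewrite divr_ge0// ltW.
apply: (@gronwall_eq0 _ _ inner inner_norm (fun s => z s - y s) _ k0) => //.
- by rewrite z00 y00 subrr.
- move=> a b a0 ab.
  have -> : z b - y b - (z a - y a) = (z b - z a) - (y b - y a).
    by rewrite !opprB addrACA [X in _ + X]addrC -addrACA.
  apply: (le_trans (ler_normB _ _)).
  by have := yl a b a0 ab; have := zl a b a0 ab; lra.
move: (solution_speed_ae sz) (solution_speed_ae sy).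
apply: (@filterS2 _ _ (ae_filter_ringOfSetsType mu)) => t zt yt t0.
have [dz z1 Nz] := zt t0; have [dy y1 Ny] := yt t0.
have dzy : derivable (fun s => z s - y s) t 1 by exact: derivableB.
split => //.
have -> : derive1 (fun s => z s - y s) t = derive1 z t - derive1 y t.
  by rewrite !derive1E; exact: deriveB.
exact: (normal_monotone t0 (zC _ t0) (yC _ t0) Nz Ny).
Qed.

End WellPosedness.

Lemma thickening_dist (R : realType) (H : normedModType R) (A : set H) (r : R) (x : H) :
  thickening A r x -> dist x A < r.
Proof.
move=> [a Aa [b br <-]]; apply: (le_lt_trans (dist_le _ Aa)).
by rewrite [X in X - a]addrC addrK; move: br; rewrite -ball_normE/= sub0r normrN.
Qed.

Theorem sweeping_well_posed (R : realType) (H : completeNormedModType R)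
    (inner : {dot H for idfun})
    (inner_norm : forall x : H, inner x x = `|x| ^+ 2)
    (r : R) (r_gt0 : 0 < r) (C : R -> set H) (y0 : H) :
  prox_regular_map r C -> excess_1lipschitz C -> thickening (C 0) r y0 ->
  exists y : R -> H, [/\ unique_solution C y0 y, Lip y & (Lip_const y <= 1)%E].
Proof.
move=> Cr Ce /thickening_dist y0r.
pose y := sweep r C y0.
have yl s t : `|y s - y t| <= `|s - t| := sweep_lipschitz inner_norm r_gt0 Cr Ce y0r s t.
have acy : loc_abs_cont y.
  apply: loc_lipschitz_abs_cont => T; exists 1 => // s t s0 st _.
  by rewrite mul1r -(ger0_norm (_ : 0 <= t - s)) ?subr_ge0.
have sy : sweeping_solution C y0 y.
  split.
  - by move=> t t0; exact: (sweep_in inner_norm r_gt0 Cr Ce y0r t0).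
  - move: (lipschitz_ae_derivable inner_norm yl) (@ae_neq0 R).
    apply: (@filterS2 _ _ (ae_filter_ringOfSetsType _)) => t dt tn0 t0.
    have {}dt : derivable y t 1 by apply: dt; rewrite lt_neqAle eq_sym tn0.
    by split => //; exact: (sweep_normal inner_norm r_gt0 Cr Ce y0r t0 dt).
  - exact: sweep0.
have y1 : (Lip_const y <= 1)%E.
  apply: ge_ereal_sup => _ [s [t [_ _ st ->]]].
  by rewrite lee_fin ler_pdivrMr ?mul1r// normr_gt0 subr_eq0 eq_sym.
exists y; split => //.
  split => // z acz sz.
  exact: (sweeping_solution_unique inner_norm r_gt0 Cr Ce acy sy acz sz).
exact: le_lt_trans y1 (ltry _).
Qed.

Theorem theorem3p1 (R : realType) (H : completeNormedModType R)
    (inner : {dot H for idfun})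
    (inner_norm : forall x : H, inner x x = `|x| ^+ 2)
    (r : R) (r_gt0 : 0 < r) :
  (forall (C : R -> set H) (y0 : H),
     prox_regular_map r C -> excess_1lipschitz C -> thickening (C 0) r y0 ->
     exists y : R -> H,
       [/\ unique_solution C y0 y, Lip y & (Lip_const y <= 1)%E]) /\
  (exists S : (R -> set H) * H -> (R -> H),
     forall p, D_Lip r p -> Lip (S p) /\ unique_solution p.1 p.2 (S p)).
Proof.
have wp := sweeping_well_posed inner_norm r_gt0; split; first exact: wp.
suff /choice[S SP] : forall p : (R -> set H) * H, exists y : R -> H,
    D_Lip r p -> Lip y /\ unique_solution p.1 p.2 y by exists S.
move=> p; have [[[Cr _] Ce y0r]|nD] := pselect (D_Lip r p); last by exists (fun=> 0).
by have [y [uy ly _]] := wp _ _ Cr Ce y0r; exists y.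
Qed.
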